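(* Let $M \models \mathsf{ZFC}$ be countable. (1) Suppose $M$ has a definable global well-order and let $P$ be a finite partial order with a least element $\mathbf 0$. Then there is an embedding $e$ of $P$ into $\mathrm{Re}_{\mathsf{GBC}}(M)$ so that $e(\mathbf 0) = \mathrm{Def}(M)$ and $e$ preserves the existence/nonexistence of upper bounds and of nonzero lower bounds (where in $\mathrm{Re}_{\mathsf{GBC}}(M)$ ``nonzero'' means different from $\mathrm{Def}(M)$). (2) Suppose $M$ does not have a definable global well-order and let $P$ be a finite partial order without a least element. Then there is an embedding $e$ of $P$ into $\mathrm{Re}_{\mathsf{GBC}}(M)$ which preserves the existence/nonexistence of upper bounds and of lower bounds. (3) Let $\mathcal X \in \mathrm{Re}_{\mathsf{GBC}}(M)$ be countable and let $P$ be a finite partial order with a least element $\mathbf 0$. Then there is an embedding $e$ of $P$ into $\mathrm{Re}_{\mathsf{GBC}}(M)$ with $e(p) \supseteq \mathcal X$ for all $p\in P$ and $e(\mathbf 0) = \mathcal X$, which preserves the existence/nonexistence of upper bounds and of nonzero lower bounds; the latter means that $p,p' \in P$ have no nonzero lower bound in $P$ if and only if $e(p)$ and $e(p')$ have $\mathcal X$ as their greatest lower bound.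
   Context: Second-order set theory is formalized in two-sorted first-order logic, with sets and classes. A model is a pair $(M,\mathcal X)$ where $M$ is the universe of sets and $\mathcal X \subseteq \mathcal P(M)$ is the collection of classes. A formula is first-order if it has no class quantifiers (class parameters are allowed). $\mathsf{GBC}$ consists of: $\mathsf{ZFC}$ for sets; Extensionality for classes; Class Replacement; Global Choice (there is a class bijection $\mathrm{Ord}\to V$); and Elementary Comprehension ($\{x : \phi(x)\}$ is a class for every first-order $\phi$ with set and class parameters). A $\mathsf{GBC}$-realization for $M$ is a set $\mathcal X \subseteq \mathcal P(M)$ with $(M,\mathcal X)\models \mathsf{GBC}$; $\mathrm{Re}_{\mathsf{GBC}}(M)$ is the set of all of them, ordered by inclusion. $\mathrm{Def}(M)$ is the collection of subsets of $M$ first-order definable over $M$ with set parameters. $M$ has a definable global well-order if $\mathrm{Def}(M)$ contains a well-order (in the sense of $M$) of all of $M$; in this case $\mathrm{Def}(M)$ is the least element of $\mathrm{Re}_{\mathsf{GBC}}(M)$. An embedding $e$ of a partial order $P$ is a map with $p \le q \iff e(p) \subseteq e(q)$. An embedding $e$ preserves the existence/nonexistence of upper bounds if for all $p,q \in P$: $p,q$ have a common upper bound in $P$ iff $e(p),e(q)$ have a common upper bound in $\mathrm{Re}_{\mathsf{GBC}}(M)$; similarly for (nonzero) lower bounds. A lower bound in $P$ is nonzero if it is not the least element $\mathbf 0$ of $P$. *)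

(* Defs.v *)
From HB Require Import structures.
From mathcomp Require Import all_boot all_order.
From mathcomp Require Import boolp classical_sets functions cardinality.

Set Implicit Arguments.
Unset Strict Implicit.
Unset Printing Implicit Defensive.

Local Open Scope classical_set_scope.

Record structure := Structure {
  carrier :> Type;
  mem : carrier -> carrier -> Prop }.

Declare Scope model_scope.
Delimit Scope model_scope with model.
Notation "x ∈ y" := (@mem _ x y) (at level 70, no associativity) : model_scope.
Local Open Scope model_scope.

(* First-order formulas (no class quantifiers) over a type K of class symbols.
   Set variables are de Bruijn indices, [fAll] binding index 0, and
   [fClass i c] says that the set x_i belongs to the class named c.
   [formula void] is the language of set theory; [formula nat] is used for
   formulas with class parameters. *)
Inductive formula (K : Type) : Type :=
  | fEq of nat & nat
  | fMem of nat & nat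
  | fClass of nat & K
  | fNot of formula K
  | fAnd of formula K & formula K
  | fAll of formula K.

Definition scons (T : Type) (x : T) (v : nat -> T) (n : nat) : T :=
  if n is n'.+1 then v n' else x.

Fixpoint sat (M : structure) (K : Type) (C : K -> set M) (v : nat -> M)
    (phi : formula K) : Prop :=
  match phi with
  | fEq i j => v i = v j
  | fMem i j => v i ∈ v j
  | fClass i c => C c (v i)
  | fNot psi => ~ sat C v psi
  | fAnd psi chi => sat C v psi /\ sat C v chi
  | fAll psi => forall x : M, sat C (scons x v) psi
  end.

Definition sat0 (M : structure) (v : nat -> M) (phi : formula void) : Prop :=
  sat (of_void (set M)) v phi.

Definition Def (M : structure) : set (set M) :=
  [set A | exists (phi : formula void) (v : nat -> M),
     A = [set x | sat0 (scons x v) phi]].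

Definition subset_in (M : structure) (x y : M) : Prop :=
  forall z : M, z ∈ x -> z ∈ y.

Definition is_upair (M : structure) (x y p : M) : Prop :=
  forall z : M, z ∈ p <-> z = x \/ z = y.

Definition is_opair (M : structure) (x y p : M) : Prop :=
  exists s t : M, [/\ is_upair x x s, is_upair x y t & is_upair s t p].

Definition rel_of (M : structure) (F : set M) (x y : M) : Prop :=
  exists p : M, is_opair x y p /\ F p.

Definition class_relation (M : structure) (F : set M) : Prop :=
  forall p : M, F p -> exists x y : M, is_opair x y p.

Definition class_function (M : structure) (F : set M) : Prop :=
  class_relation F /\
  forall x y y' : M, rel_of F x y -> rel_of F x y' -> y = y'.

(* Strict well-order of D in the sense of M: minimal elements are required for
   the nonempty subsets of D that are elements of M only. *)
Definition well_orders (M : structure) (D : set M) (R : M -> M -> Prop) : Prop :=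
  [/\ forall x : M, D x -> ~ R x x,
      forall x y z : M, D x -> D y -> D z -> R x y -> R y z -> R x z,
      forall x y : M, D x -> D y -> [\/ R x y, x = y | R y x] &
      forall a : M, (forall x : M, x ∈ a -> D x) -> (exists x : M, x ∈ a) ->
        exists2 x : M, x ∈ a & forall y : M, y ∈ a -> x = y \/ R x y].

Definition is_ordinal (M : structure) (x : M) : Prop :=
  (forall y : M, y ∈ x -> subset_in y x) /\
  well_orders [set y : M | y ∈ x] (@mem M).

Record ZFC (M : structure) : Prop := {
  zfc_extensionality : forall x y : M, (forall z : M, z ∈ x <-> z ∈ y) -> x = y;
  zfc_foundation : forall x : M, (exists y : M, y ∈ x) ->
    exists2 y : M, y ∈ x & forall z : M, z ∈ x -> ~ z ∈ y;
  zfc_pairing : forall x y : M, exists p : M, is_upair x y p;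
  zfc_union : forall x : M, exists u : M, forall z : M,
    z ∈ u <-> exists y : M, y ∈ x /\ z ∈ y;
  zfc_powerset : forall x : M, exists p : M, forall z : M,
    z ∈ p <-> subset_in z x;
  zfc_infinity : exists w : M,
    (exists2 o : M, o ∈ w & forall z : M, ~ z ∈ o) /\
    (forall x : M, x ∈ w ->
       exists2 s : M, s ∈ w & forall z : M, z ∈ s <-> z ∈ x \/ z = x);
  zfc_separation : forall (phi : formula void) (v : nat -> M) (a : M),
    exists b : M, forall x : M, x ∈ b <-> x ∈ a /\ sat0 (scons x v) phi;
  zfc_replacement : forall (phi : formula void) (v : nat -> M) (a : M),
    (forall x y y' : M, x ∈ a ->
       sat0 (scons x (scons y v)) phi -> sat0 (scons x (scons y' v)) phi ->
       y = y') ->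
    exists b : M, forall y : M,
      y ∈ b <-> exists x : M, x ∈ a /\ sat0 (scons x (scons y v)) phi;
  zfc_choice : forall a : M,
    (forall x : M, x ∈ a -> exists z : M, z ∈ x) ->
    (forall x y z : M, x ∈ a -> y ∈ a -> z ∈ x -> z ∈ y -> x = y) ->
    exists c : M, forall x : M, x ∈ a -> exists! z : M, z ∈ x /\ z ∈ c }.

(* Extensionality for classes holds automatically: classes are subsets of M. *)
Record GBC (M : structure) (X : set (set M)) : Prop := {
  gbc_zfc : ZFC M;
  gbc_class_replacement : forall F : set M, X F -> class_function F ->
    forall a : M, exists b : M, forall y : M,
      y ∈ b <-> exists x : M, x ∈ a /\ rel_of F x y;
  gbc_global_choice : exists F : set M,
    [/\ X F, class_function F,
        forall x : M, is_ordinal x <-> exists y : M, rel_of F x y,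
        forall x x' y : M, rel_of F x y -> rel_of F x' y -> x = x' &
        forall y : M, exists x : M, rel_of F x y];
  gbc_comprehension : forall (phi : formula nat) (v : nat -> M)
      (C : nat -> set M), (forall c : nat, X (C c)) ->
    X [set x | sat C (scons x v) phi] }.

Definition Re_GBC (M : structure) : set (set (set M)) := [set X | GBC X].

Definition has_definable_global_wellorder (M : structure) : Prop :=
  exists R : set M,
    [/\ Def R, class_relation R & well_orders [set: M] (rel_of R)].

Section Embeddings.
Context (M : structure) (d : Order.disp_t) (P : finPOrderType d).
Implicit Types (e : P -> set (set M)) (zero : P).

Definition embedding_in_Re e : Prop :=
  (forall p : P, Re_GBC (e p)) /\
  (forall p q : P, (p <= q)%O <-> e p `<=` e q).

Definition preserves_upper_bounds e : Prop := forall p q : P,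
  (exists r : P, (p <= r)%O /\ (q <= r)%O) <->
  (exists Y : set (set M), [/\ Re_GBC Y, e p `<=` Y & e q `<=` Y]).

Definition preserves_lower_bounds e : Prop := forall p q : P,
  (exists r : P, (r <= p)%O /\ (r <= q)%O) <->
  (exists Y : set (set M), [/\ Re_GBC Y, Y `<=` e p & Y `<=` e q]).

Definition has_nonzero_lower_bound zero (p q : P) : Prop :=
  exists r : P, [/\ (r <= p)%O, (r <= q)%O & r <> zero].

Definition preserves_nonzero_lower_bounds zero e : Prop := forall p q : P,
  has_nonzero_lower_bound zero p q <->
  (exists Y : set (set M),
     [/\ Re_GBC Y, Y `<=` e p, Y `<=` e q & Y <> @Def M]).

Definition is_glb_in_Re (Z A B : set (set M)) : Prop :=
  [/\ Re_GBC Z, Z `<=` A, Z `<=` B &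
      forall Y : set (set M), Re_GBC Y -> Y `<=` A -> Y `<=` B -> Y `<=` Z].

Definition preserves_nonzero_lower_bounds_over zero (X : set (set M)) e : Prop :=
  forall p q : P,
    ~ has_nonzero_lower_bound zero p q <-> is_glb_in_Re X (e p) (e q).

End Embeddings.

(* Main.v *)
Require Import Defs.
From mathcomp Require Import all_boot all_order.
From mathcomp Require Import boolp classical_sets functions cardinality.

(* Given a countable collection X of classes satisfying GBC except possibly
   global choice, force over X with set-sized injective sequences of ordinal
   length. Every set-sized chain of conditions has a lower bound, so no sets are
   added, the forcing relation is first-order definable without names, and a
   generic bijection Ord -> V preserves class replacement and provides global
   choice. Attach such a class C_r to each element r of P (except to the least
   element in (1) and (3)) and let e(p) consist of the classes definable from X
   and the C_r with r <= p.
   The C_r are built in countably many moves. A move extends freely only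
   coordinates below a common upper bound, pads the others with non-markers, and
   then marks a common position in all coordinates. Hence {C_r : r <= p} is
   generic over X, whereas for p, q without upper bound the positions marked in
   both C_p and C_q form a cofinal subset of Ord with externally finite initial
   segments, so C_p and C_q lie in no common realization. Further moves make
   classes definable from disjoint parts of the family agree only if they are in
   X, which settles lower bounds. *)

Set Implicit Arguments.
Unset Strict Implicit.
Unset Printing Implicit Defensive.

Local Open Scope classical_set_scope.
Local Open Scope model_scope.

(** * Definable relations *)

(** Genericity is asked only of families without clashing pairs, and small intersections are
    arranged by hand. At a given state the construction looks for two moves after which the two
    forcing relations disagree about some set, and makes them if they exist. If none exist, a class
    common to both extensions is already decided by that state, hence lies in [X]. The argument
    turns on the fact that a move acts on a coordinate outside its free part in a way that depends
    only on the present sequence and the position [d]. [M] may be ill-founded, even in its natural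
    numbers. Induction and least elements are therefore restricted to definable classes, and
    finiteness of the common markers is meant externally. The ground collection in (2) is [Def M],
    where global choice fails. For this reason the whole theory of the ground model is developed
    without it. *)

Definition vtail (T : Type) (v : nat -> T) (n : nat) : T := v n.+1.

(** A semantic counterpart of formulas with class parameters: definability of a proposition is
    derived by following its shape, without ever writing de Bruijn syntax for it. *)
Inductive dfn (M : structure) (X : set (set M)) : ((nat -> M) -> Prop) -> Prop :=
  | dfn_eq0 i j : dfn X (fun v => v i = v j)
  | dfn_mem0 i j : dfn X (fun v => v i ∈ v j)
  | dfn_class0 A i : X A -> dfn X (fun v => A (v i))
  | dfn_not R : dfn X R -> dfn X (fun v => ~ R v)
  | dfn_and R S : dfn X R -> dfn X S -> dfn X (fun v => R v /\ S v)
  | dfn_all0 R : dfn X R -> dfn X (fun v => forall x, R (scons x v)).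

(* The classes needed to replace a variable by a set parameter. *)
Definition has_params (M : structure) (X : set (set M)) : Prop := forall a : M,
  [/\ X [set a], X [set z | z ∈ a] & X [set z | a ∈ z]].

Definition trm (M : structure) (t : (nat -> M) -> M) : Prop :=
  (exists i, t = fun v => v i) \/ (exists a, t = fun=> a).

Section Definability.
Context (M : structure) (X : set (set M)).
Implicit Types R S : (nat -> M) -> Prop.

Lemma trm_var i : trm (fun v : nat -> M => v i).
Proof. by left; exists i. Qed.

Lemma trm_cst (a : M) : trm (fun=> a).
Proof. by right; exists a. Qed.

Lemma dfn_iff R S : (forall v, R v <-> S v) -> dfn X R -> dfn X S.
Proof. by move=> RS dR; have <- : R = S by apply/funext => v; apply/propext. Qed.

Lemma dfn_true : dfn X (fun=> True).
Proof. by apply: dfn_iff (dfn_eq0 X 0 0). Qed.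

Lemma dfn_cst (Q : Prop) : dfn X (fun=> Q).
Proof.
have [q|nq] := EM Q; first by apply: dfn_iff dfn_true.
by apply: dfn_iff (dfn_not dfn_true) => v; split=> // /(_ I).
Qed.

Lemma dfn_all (R : (nat -> M) -> M -> Prop) :
  dfn X (fun v => R (vtail v) (v 0)) -> dfn X (fun v => forall x, R v x).
Proof. exact: dfn_all0. Qed.

Lemma dfn_or R S : dfn X R -> dfn X S -> dfn X (fun v => R v \/ S v).
Proof.
move=> dR dS; apply: dfn_iff (dfn_not (dfn_and (dfn_not dR) (dfn_not dS))) => v.
split=> [/not_andP[]/contrapT|[]]; [by left|by right|by move=> r []|by move=> s []].
Qed.

Lemma dfn_imp R S : dfn X R -> dfn X S -> dfn X (fun v => R v -> S v).
Proof.
move=> dR dS; apply: dfn_iff (dfn_or (dfn_not dR) dS) => v.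
by split=> [[]//|rs]; have [/rs|] := EM (R v); [right|left].
Qed.

Lemma dfn_equiv R S : dfn X R -> dfn X S -> dfn X (fun v => R v <-> S v).
Proof. by move=> dR dS; apply: dfn_and; apply: dfn_imp. Qed.

Lemma dfn_ex (R : (nat -> M) -> M -> Prop) :
  dfn X (fun v => R (vtail v) (v 0)) -> dfn X (fun v => exists x, R v x).
Proof.
move=> dR; apply: (@dfn_iff (fun v => ~ forall x, ~ R v x)) => [v|].
  by split=> [/existsNP[x /contrapT]|[x rx] /(_ x)]; [exists x|].
by apply/dfn_not/dfn_all/dfn_not.
Qed.

Lemma dfn_ex2 (R S : (nat -> M) -> M -> Prop) :
  dfn X (fun v => R (vtail v) (v 0)) -> dfn X (fun v => S (vtail v) (v 0)) ->
  dfn X (fun v => exists2 x, R v x & S v x).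
Proof.
move=> dR dS; apply: (@dfn_iff (fun v => exists x, R v x /\ S v x)) => [v|].
  by split=> [[x []]|[x]]; exists x.
by apply: dfn_ex; apply: dfn_and.
Qed.

Lemma dfn_and3 R S T : dfn X R -> dfn X S -> dfn X T ->
  dfn X (fun v => [/\ R v, S v & T v]).
Proof.
move=> dR dS dT; apply: dfn_iff (dfn_and dR (dfn_and dS dT)) => v.
by split=> [[? []]|[]].
Qed.

Lemma dfn_bigand (I : finType) (R : I -> (nat -> M) -> Prop) :
  (forall i, dfn X (R i)) -> dfn X (fun v => forall i, R i v).
Proof.
move=> dR; apply: (@dfn_iff (fun v => forall i, i \in enum I -> R i v)) => [v|].
  by split=> h i; [apply: h; rewrite mem_enum|].
elim: (enum I) => [|i s IH]; first by apply: dfn_iff dfn_true.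
apply: dfn_iff (dfn_and (dR i) IH) => v; split=> [[h hs] j|h].
  by rewrite inE => /predU1P[->|/hs].
by split=> [|j js]; apply: h; rewrite inE ?eqxx// js orbT.
Qed.

Hypothesis Xp : has_params X.

(** Induction on the definition. At an atom a constant disappears into one of the three classes of
    [has_params]; under a quantifier the substitution is shifted and fixes the bound variable. *)
Lemma dfn_subst R (s : nat -> (nat -> M) -> M) :
  (forall n, trm (s n)) -> dfn X R -> dfn X (fun v => R (fun n => s n v)).
Proof.
move=> st dR; elim: dR s st => {R}.
- move=> i j s st; case: (st i) => -[a ->]; case: (st j) => -[b ->].
  + exact: dfn_eq0.
  + by apply: (@dfn_class0 _ _ [set b]); have [] := Xp b.
  + apply: (@dfn_iff (fun v => [set a] (v b))) => [v|]; first by split.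
    by apply: dfn_class0; have [] := Xp a.
  + exact: dfn_cst.
- move=> i j s st; case: (st i) => -[a ->]; case: (st j) => -[b ->].
  + exact: dfn_mem0.
  + by apply: (@dfn_class0 _ _ [set z | z ∈ b]); have [] := Xp b.
  + by apply: (@dfn_class0 _ _ [set z | a ∈ z]); have [] := Xp a.
  + exact: dfn_cst.
- move=> A i XA s st; case: (st i) => -[a ->]; first exact: dfn_class0.
  exact: dfn_cst.
- by move=> R _ IH s st; apply/dfn_not/IH.
- by move=> R S _ IHR _ IHS s st; apply: dfn_and; [apply: IHR|apply: IHS].
- move=> R _ IH s st.
  pose s' n v := if n is n'.+1 then s n' (vtail v) else v 0 : M.
  have st' n : trm (s' n).
    case: n => [|n]; first exact: trm_var.
    case: (st n) => -[a e]; [left; exists a.+1|right; exists a];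
      by rewrite /s' e.
  apply: dfn_iff (dfn_all0 (IH s' st')) => v.
  have e x : scons x (fun n => s n v) = (fun n => s' n (scons x v)).
    by apply/funext; case.
  by split=> h x; move: (h x); rewrite e.
Qed.

Lemma dfn_eq t u : trm t -> trm u -> dfn X (fun v => t v = u v).
Proof.
move=> tt tu; apply: (@dfn_subst (fun v => v 0 = v 1)
  (fun n => if n is 0 then t else u)) => [[]//|].
exact: dfn_eq0.
Qed.

Lemma dfn_mem t u : trm t -> trm u -> dfn X (fun v => t v ∈ u v).
Proof.
move=> tt tu; apply: (@dfn_subst (fun v => v 0 ∈ v 1)
  (fun n => if n is 0 then t else u)) => [[]//|].
exact: dfn_mem0.
Qed.

Definition dfn1 (Q : M -> Prop) := dfn X (fun v => Q (v 0)).
Definition dfn2 (Q : M -> M -> Prop) := dfn X (fun v => Q (v 0) (v 1)).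
Definition dfn3 (Q : M -> M -> M -> Prop) := dfn X (fun v => Q (v 0) (v 1) (v 2)).
Lemma dfn1_class A : X A -> dfn1 A.
Proof. exact: dfn_class0. Qed.

Lemma dfn1_trm Q t : dfn1 Q -> trm t -> dfn X (fun v => Q (t v)).
Proof. by move=> dQ tt; apply: (@dfn_subst (fun v => Q (v 0)) (fun=> t)). Qed.

Lemma dfn2_trm Q t u : dfn2 Q -> trm t -> trm u -> dfn X (fun v => Q (t v) (u v)).
Proof.
move=> dQ tt tu; apply: (@dfn_subst (fun v => Q (v 0) (v 1))
  (fun n => if n is 0 then t else u)) => // -[]//.
Qed.

Lemma dfn3_trm Q t u w : dfn3 Q -> trm t -> trm u -> trm w ->
  dfn X (fun v => Q (t v) (u v) (w v)).
Proof.
move=> dQ tt tu tw; apply: (@dfn_subst (fun v => Q (v 0) (v 1) (v 2))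
  (fun n => match n with 0 => t | 1 => u | _ => w end)) => // -[|[]]//.
Qed.

End Definability.

Create HintDb dfn.
#[global] Hint Resolve dfn1_class : dfn.

Ltac trm_tac := cbv beta;
  first [ exact: trm_var | exact: trm_cst
        | left; eexists; reflexivity | right; eexists; reflexivity ].

Ltac dfn_rel := match goal with
  | |- dfn ?X (fun v => ?Q (@?t v) (@?u v) (@?w v)) =>
      apply: (@dfn3_trm _ X _ Q t u w);
      [by [] | by eauto with dfn nocore | trm_tac ..]
  | |- dfn ?X (fun v => ?Q (@?t v) (@?u v)) =>
      apply: (@dfn2_trm _ X _ Q t u);
      [by [] | by eauto with dfn nocore | trm_tac ..]
  | |- dfn ?X (fun v => ?Q (@?t v)) =>
      apply: (@dfn1_trm _ X _ Q t);
      [by [] | by eauto with dfn nocore | trm_tac ..]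
  end.

Ltac dfn_step := lazymatch goal with
  | |- dfn _ (fun v => forall x : carrier _, @?R v x) => apply: (@dfn_all _ _ R)
  | |- dfn _ (fun v => exists x, @?R v x) => apply: (@dfn_ex _ _ R)
  | |- dfn _ (fun v => exists2 x, @?R v x & @?S v x) => apply: (@dfn_ex2 _ _ R S)
  | |- dfn _ (fun v => ~ _) => apply: dfn_not
  | |- dfn _ (fun v => _ /\ _) => apply: dfn_and
  | |- dfn _ (fun v => [/\ _, _ & _]) => apply: dfn_and3
  | |- dfn _ (fun v => _ \/ _) => apply: dfn_or
  | |- dfn _ (fun v => _ <-> _) => apply: dfn_equiv
  | |- dfn _ (fun v => @Defs.mem _ _ _) => apply: dfn_mem; [by [] | trm_tac ..]
  | |- dfn _ (fun v => _ = _) => apply: dfn_eq; [by [] | trm_tac ..]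
  | |- dfn _ (fun v => @?P v -> @?Q v) => apply: (@dfn_imp _ _ P Q)
  | |- _ => first [ exact: dfn_cst | dfn_rel ]
  end.
Ltac dfn_tac := rewrite /dfn1 /dfn2 /dfn3; repeat (cbv beta; dfn_step).

(** * Syntactic formulas, and the closure of a collection of classes under definability *)

Fixpoint rename_vars (K : Type) (f : nat -> nat) (phi : formula K) : formula K :=
  match phi with
  | fEq i j => fEq K (f i) (f j)
  | fMem i j => fMem K (f i) (f j)
  | fClass i c => fClass (f i) c
  | fNot p => fNot (rename_vars f p)
  | fAnd p q => fAnd (rename_vars f p) (rename_vars f q)
  | fAll p => fAll (rename_vars (fun n => if n is n'.+1 then (f n').+1 else 0) p)
  end.

Fixpoint rename_classes (K L : Type) (f : K -> L) (phi : formula K) : formula L :=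
  match phi with
  | fEq i j => fEq L i j
  | fMem i j => fMem L i j
  | fClass i c => fClass i (f c)
  | fNot p => fNot (rename_classes f p)
  | fAnd p q => fAnd (rename_classes f p) (rename_classes f q)
  | fAll p => fAll (rename_classes f p)
  end.

Section Formulas.
Context (M : structure).
Implicit Types (v : nat -> M) (S T : set (set M)) (R : (nat -> M) -> Prop).

Lemma sat_rename_vars K (C : K -> set M) (phi : formula K) f v :
  sat C v (rename_vars f phi) <-> sat C (v \o f) phi.
Proof.
elim: phi f v => //= [p IH|p IHp q IHq|p IH] f v; rewrite ?IH ?IHp ?IHq//.
suff e x : scons x v \o (fun n => if n is n'.+1 then (f n').+1 else 0) =
    scons x (v \o f) by split=> h x; move/(_ x): h; rewrite IH e.
by apply/funext; case.
Qed.

Lemma sat_rename_classes K L (C : L -> set M) (f : K -> L) (phi : formula K) v :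
  sat C v (rename_classes f phi) <-> sat (C \o f) v phi.
Proof.
elim: phi v => //= [p IH|p IHp q IHq|p IH] v; rewrite ?IH ?IHp ?IHq//.
by split=> h x; move/(_ x): h; rewrite IH.
Qed.

Lemma sat_dfn (X : set (set M)) K (C : K -> set M) (phi : formula K) :
  (forall c, X (C c)) -> dfn X (fun v => sat C v phi).
Proof.
move=> XC; elim: phi => /=.
- exact: dfn_eq0.
- exact: dfn_mem0.
- by move=> i c; apply: dfn_class0.
- by move=> p; apply: dfn_not.
- by move=> p Hp q Hq; apply: dfn_and.
- by move=> p; apply: dfn_all0.
Qed.

(** The way back from [dfn] to syntax, required because comprehension in [GBC] speaks of formulas. A
    formula comes with a total list of parameters, so some class must be there to fill it. *)
Lemma dfn_formula (X : set (set M)) R : X !=set0 -> dfn X R ->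
  exists (phi : formula nat) (C : nat -> set M),
    (forall c, X (C c)) /\ forall v, R v <-> sat C v phi.
Proof.
move=> [B XB]; elim=> {R}.
- by move=> i j; exists (fEq nat i j), (fun=> B).
- by move=> i j; exists (fMem nat i j), (fun=> B).
- by move=> A i XA; exists (fClass i 0), (fun=> A).
- move=> R _ [p [C [XC h]]]; exists (fNot p), C; split=> // v /=.
  by rewrite h.
- move=> R S _ [p [C [XC h]]] _ [q [D [XD k]]].
  (* Even symbols carry the parameters of [p], odd symbols those of [q]. *)
  exists (fAnd (rename_classes double p) (rename_classes (fun n => n.*2.+1) q)).
  exists (fun c => if odd c then D c./2 else C c./2).
  split=> [c|v /=]; first by case: ifP.
  rewrite h k !sat_rename_classes.
  have -> : (fun c => if odd c then D c./2 else C c./2) \o double = C.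
    by apply/funext => n /=; rewrite odd_double doubleK.
  have -> // : (fun c => if odd c then D c./2 else C c./2) \o
      (fun n => n.*2.+1) = D.
  by apply/funext => n /=; rewrite odd_double/= uphalf_double.
- move=> R _ [p [C [XC h]]]; exists (fAll p), C; split=> // v /=.
  by split=> H x; apply/h.
Qed.

Definition comprehensive (X : set (set M)) : Prop := forall R v,
  dfn X R -> X [set x | R (scons x v)].

Definition gen (S : set (set M)) : set (set M) :=
  [set A | dfn S (fun v => A (v 0))].

Lemma dfn_gen S R : has_params S -> dfn (gen S) R -> dfn S R.
Proof.
move=> Sp; elim=> {R}.
- exact: dfn_eq0.
- exact: dfn_mem0.
- move=> A i dA; apply: (@dfn1_trm _ _ Sp A _ dA); exact: trm_var.
- by move=> R _; apply: dfn_not.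
- by move=> R T _ + _; apply: dfn_and.
- by move=> R _; apply: dfn_all0.
Qed.

Lemma dfn_sub S T R : S `<=` T -> dfn S R -> dfn T R.
Proof.
move=> ST; elim=> {R}.
- exact: dfn_eq0.
- exact: dfn_mem0.
- by move=> A i /ST; apply: dfn_class0.
- by move=> R _; apply: dfn_not.
- by move=> R Q _ + _; apply: dfn_and.
- by move=> R _; apply: dfn_all0.
Qed.

Lemma gen_sub S T : S `<=` T -> gen S `<=` gen T.
Proof. by move=> ST A; apply: dfn_sub. Qed.

Lemma sub_gen S : S `<=` gen S.
Proof. by move=> A SA; apply: dfn_class0. Qed.

Lemma comprehensive_gen S : has_params S -> comprehensive (gen S).
Proof.
move=> Sp R v /(dfn_gen Sp) dR.
have := @dfn_subst _ _ Sp R (fun n v' => if n is n'.+1 then v n' else v' 0) _ dR.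
move=> H; apply: dfn_iff (H _) => [w|[|n]] /=; [|exact: trm_var|exact: trm_cst].
suff -> : scons (w 0) v = fun n => if n is n'.+1 then v n' else w 0 by [].
by apply/funext; case.
Qed.

Lemma gen_comprehensive X (x0 : M) : comprehensive X -> gen X = X.
Proof.
move=> cX; apply/seteqP; split=> [A dA|]; last exact: sub_gen.
exact: cX (fun=> x0) dA.
Qed.

Lemma comprehensive_params X : comprehensive X -> has_params X.
Proof.
move=> cX a; split.
- exact: (cX _ (fun=> a) (dfn_eq0 X 0 1)).
- exact: (cX _ (fun=> a) (dfn_mem0 X 0 1)).
- exact: (cX _ (fun=> a) (dfn_mem0 X 1 0)).
Qed.

End Formulas.

(** [GBC] without global choice. This generality lets [Def M] serve as ground model when [M] has no
    definable global well-order. *)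
Record GB (M : structure) (X : set (set M)) : Prop := {
  gb_zfc : ZFC M;
  gb_class_replacement : forall F : set M, X F -> class_function F ->
    forall a : M, exists b : M, forall y : M,
      y ∈ b <-> exists x : M, x ∈ a /\ rel_of F x y;
  gb_comprehension : comprehensive X }.

Definition global_choice (M : structure) (X : set (set M)) : Prop :=
  exists F : set M,
    [/\ X F, class_function F,
        forall x : M, is_ordinal x <-> exists y : M, rel_of F x y,
        forall x x' y : M, rel_of F x y -> rel_of F x' y -> x = x' &
        forall y : M, exists x : M, rel_of F x y].

Section GBC_GB.
Context (M : structure).

Lemma GBC_nonempty (X : set (set M)) : GBC X -> X !=set0.
Proof. by case=> _ _ [F [XF _ _ _ _]] _; exists F. Qed.

Lemma GBC_GB (X : set (set M)) : GBC X -> GB X.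
Proof.
move=> XG; split; [exact: gbc_zfc XG|exact: gbc_class_replacement XG|].
move=> R v /(dfn_formula (GBC_nonempty XG))[phi [C [XC h]]].
have -> : [set x | R (scons x v)] = [set x | sat C (scons x v) phi].
  by apply/seteqP; split=> x /h.
exact: gbc_comprehension XG _ _ _ XC.
Qed.

Lemma GB_GBC (X : set (set M)) : GB X -> global_choice X -> GBC X.
Proof.
move=> XG gc; split=> //; [exact: gb_zfc XG|exact: gb_class_replacement XG|].
move=> phi v C XC; apply: (gb_comprehension XG (R := fun v => sat C v phi)).
exact: sat_dfn.
Qed.

End GBC_GB.

(** * The classes definable with set parameters *)

Section DefClasses.
Context (M : structure).
Implicit Types (u v w : nat -> M).

Definition interleave u v (n : nat) : M := if odd n then v n./2 else u n./2.

Lemma interleave_even u v n : interleave u v n.*2 = u n.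
Proof. by rewrite /interleave odd_double doubleK. Qed.

Lemma interleave_odd u v n : interleave u v n.*2.+1 = v n.
Proof. by rewrite /interleave /= odd_double/= uphalf_double. Qed.

(* All set parameters of a definition are collected in one valuation, which
   occupies the odd variables. *)
Definition pdfn (R : (nat -> M) -> Prop) : Prop :=
  exists (phi : formula void) u, forall v, R v <-> sat0 (interleave v u) phi.

Lemma eq_sat0 v w phi : v =1 w -> sat0 v phi -> sat0 w phi.
Proof. by move=> /funext->. Qed.

Lemma pdfn_of_Def (x0 : M) R : dfn (@Def M) R -> pdfn R.
Proof.
elim=> {R}.
- move=> i j; exists (fEq void i.*2 j.*2), (fun=> x0) => v.
  by rewrite /sat0 /= !interleave_even.
- move=> i j; exists (fMem void i.*2 j.*2), (fun=> x0) => v.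
  by rewrite /sat0 /= !interleave_even.
- move=> _ i [phi [w ->]].
  exists (rename_vars (fun n => if n is n'.+1 then n'.*2.+1 else i.*2) phi), w => v.
  rewrite /sat0 sat_rename_vars /=.
  by split; apply: eq_sat0 => -[|n] /=; rewrite ?interleave_even ?interleave_odd.
- move=> R _ [phi [u h]]; exists (fNot phi), u => v.
  by rewrite h.
- move=> R S _ [p [u h]] _ [q [w k]].
  (* The parameter of index k in [u] gets index 2k in [interleave u w], so variable 2k+1 becomes
     4k+1; for [w] in [f2] it becomes 4k+3. The even variables stay. *)
  pose f1 n := if odd n then (n./2.*2).*2.+1 else n.
  pose f2 n := if odd n then (n./2.*2.+1).*2.+1 else n.
  exists (fAnd (rename_vars f1 p) (rename_vars f2 q)), (interleave u w) => v.
  rewrite h k /sat0 /= !sat_rename_vars.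
  have -> : interleave v (interleave u w) \o f1 = interleave v u.
    apply/funext => n; rewrite /= /f1; case: ifP => on.
      by rewrite interleave_odd interleave_even /interleave on.
    by rewrite /interleave on.
  have -> // : interleave v (interleave u w) \o f2 = interleave v w.
  apply/funext => n; rewrite /= /f2; case: ifP => on.
    by rewrite interleave_odd interleave_odd /interleave on.
  by rewrite /interleave on.
- move=> R _ [p [u h]].
  (* Binding a variable shifts all others by one and so reverses their parity; [f] exchanges 2k+1
     and 2k+2 to compensate. *)
  pose f n := if n is n'.+1 then (if odd n then n.+1 else n') else 0.
  exists (fAll (rename_vars f p)), u => v.
  suff e x : R (scons x v) <->
      sat (of_void (set M)) (scons x (interleave v u)) (rename_vars f p).
    by split=> H x; apply/e.
  rewrite h sat_rename_vars /sat0.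
  suff -> : interleave (scons x v) u = scons x (interleave v u) \o f by [].
  apply/funext => -[|n]//; rewrite /f /interleave /=.
  case: ifP => [on|/negbFE on] /=.
    by rewrite on uphalf_half (negbTE on).
  by case: n on => //= n /negbTE on; rewrite on.
Qed.

Lemma Def_of_pdfn (x0 : M) R v : pdfn R -> Def [set x | R (scons x v)].
Proof.
move=> [phi [u h]].
exists (rename_vars (fun n => if n is n'.+1 then (if odd n then (n'./2).*2.+2
  else (n'./2).*2.+1) else 0) phi), (interleave v u).
suff e x : scons x (interleave v u) \o (fun n => if n is n'.+1 then
    (if odd n then (n'./2).*2.+2 else (n'./2).*2.+1) else 0) =
    interleave (scons x v) u.
  by apply/seteqP; split=> x /=; rewrite h /sat0 sat_rename_vars e.
apply/funext => -[|n]//; rewrite /interleave/= uphalf_half.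
by case on: (odd n); rewrite //= odd_double/= ?doubleK ?uphalf_double.
Qed.

Lemma comprehensive_Def (x0 : M) : comprehensive (@Def M).
Proof. by move=> R v /(pdfn_of_Def x0); apply: Def_of_pdfn. Qed.

Lemma Def_sub (x0 : M) X : comprehensive X -> @Def M `<=` X.
Proof.
move=> cX _ [phi [v ->]].
by apply: (cX (fun v => sat0 v phi)); apply: sat_dfn => -[].
Qed.

Lemma GB_Def : ZFC M -> GB (@Def M).
Proof.
move=> Z; have [w [[x0 _ _] _]] := zfc_infinity Z.
have cD := comprehensive_Def x0; have Dp := comprehensive_params cD.
split=> // F DF [_ Ffun] a.
have : dfn2 (@Def M) (rel_of F).
  by rewrite /rel_of /is_opair /is_upair; dfn_tac.
move=> /(pdfn_of_Def x0)[phi [u h]].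
(* The arguments move from variables 0 and 2 to 0 and 1, and parameter k from 2k+1 to k+2. The other
   even variables have the dummy value [u 0], which is found at 2. *)
pose f n := if odd n then n./2.+2 else if n is 0 then 0 else
  if n is 2 then 1 else 2.
have e x y : sat0 (scons x (scons y u)) (rename_vars f phi) <-> rel_of F x y.
  have := h (scons x (scons y (fun=> u 0))); rewrite /= => ->.
  rewrite /sat0 sat_rename_vars.
  suff -> : scons x (scons y u) \o f =
    interleave (scons x (scons y (fun=> u 0))) u by [].
  apply/funext => n; rewrite /= /f /interleave; case: ifP => //= on.
  by case: n on => [|[|[|[|n]]]].
have [|b hb] := zfc_replacement Z (phi := rename_vars f phi) (v := u) (a := a).
  by move=> x y y' _ /e xy /e; apply: Ffun.
by exists b => y; rewrite hb; split=> -[x [xa /e xy]]; exists x.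
Qed.

Lemma sat_bounded K (C : K -> set M) (phi : formula K) :
  exists n, forall v w, (forall i, (i < n)%N -> v i = w i) ->
    sat C v phi -> sat C w phi.
Proof.
suff [n h] : exists n, forall v w, (forall i, (i < n)%N -> v i = w i) ->
    sat C v phi <-> sat C w phi by exists n => v w /h[].
elim: phi => /=.
- move=> i j; exists (maxn i j).+1 => v w e.
  by rewrite !e// ltnS ?leq_maxl ?leq_maxr.
- move=> i j; exists (maxn i j).+1 => v w e.
  by rewrite !e// ltnS ?leq_maxl ?leq_maxr.
- by move=> i c; exists i.+1 => v w e; rewrite e.
- by move=> p [n h]; exists n => v w /h->.
- move=> p [n h] q [m k]; exists (maxn n m) => v w e.
  rewrite (h v w) ?(k v w)// => i im; apply: e; rewrite (leq_trans im)//.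
    exact: leq_maxr.
  exact: leq_maxl.
- move=> p [n h]; exists n => v w e.
  have e' x i : (i < n)%N -> scons x v i = scons x w i.
    by case: i => //= i lin; apply: e; apply: ltnW.
  by split=> H x; [rewrite -(h (scons x v))//|rewrite (h (scons x v) (scons x w))//];
    apply: e'.
Qed.

(** [GenTree.tree nat] is a countable type, so an injection into it bounds the number of
    formulas. *)
Fixpoint formula_tree (phi : formula void) : GenTree.tree nat :=
  match phi with
  | fEq i j => GenTree.Node 0 [:: GenTree.Leaf i; GenTree.Leaf j]
  | fMem i j => GenTree.Node 1 [:: GenTree.Leaf i; GenTree.Leaf j]
  | fClass _ c => match c with end
  | fNot p => GenTree.Node 2 [:: formula_tree p]
  | fAnd p q => GenTree.Node 3 [:: formula_tree p; formula_tree q]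
  | fAll p => GenTree.Node 4 [:: formula_tree p]
  end.

Lemma formula_tree_inj : injective formula_tree.
Proof.
elim=> [i j|i j|i []|p IH|p IHp q IHq|p IH] [i' j'|i' j'|i' []|p'|p' q'|p'] //=.
- by case=> -> ->.
- by case=> -> ->.
- by case=> /IH->.
- by case=> /IHp-> /IHq->.
- by case=> /IH->.
Qed.

Lemma countable_Def (x0 : M) : countable [set: M] -> countable (@Def M).
Proof.
move=> /countable_injP[f finj].
(* By [sat_bounded] a formula and a finite list of parameters determine a definable class. Each code
   thus names at most one class, and [Def M] is covered by countably many sets with at most one
   element. *)
pose g (x : GenTree.tree nat * seq nat) : set (set M) :=
  [set A | exists2 ps : formula void * seq M,
     (formula_tree ps.1, map f ps.2) = x &
     A = [set y | sat0 (scons y (nth x0 ps.2)) ps.1]].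
have g1 x A B : g x A -> g x B -> A = B.
  move=> [[p s] /= <- ->] [[q t] /= [/formula_tree_inj-> st] ->].
  suff -> : s = t by [].
  by apply: inj_map (esym st) => a b; apply: finj; rewrite inE.
suff : @Def M `<=` \bigcup_(x in [set: GenTree.tree nat * seq nat]) g x.
  move=> /subset_card_le/sub_countable; apply; apply: bigcup_countable => // x _.
  have [[A gA]|n] := EM (exists A, g x A).
    by have /subset_card_le/sub_countable : g x `<=` [set A] by
      [move=> B /g1; apply|]; apply.
  by have /subset_card_le/sub_countable : g x `<=` set0 by
    [move=> B gB; apply: n; exists B|]; apply.
move=> _ [phi [v ->]].
have [n h] := sat_bounded (of_void (set M)) phi.
exists (formula_tree phi, map f (mkseq v n)) => //.
exists (phi, mkseq v n) => //=.
have e x i : (i < n)%N -> scons x v i = scons x (nth x0 (mkseq v n)) i.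
  by case: i => //= i lin; rewrite nth_mkseq// ltnW.
by apply/seteqP; split=> x; apply: h => i /e ->.
Qed.

End DefClasses.

(** * Elementary set theory inside the model *)

Section Sets.
Context (M : structure) (Z : ZFC M).
Implicit Types (a b c p s t x y z : M) (Q : M -> Prop).

Definition is_set Q := exists b, forall x, x ∈ b <-> Q x.

Lemma model_inhabited : exists x : M, True.
Proof. by have [w _] := zfc_infinity Z; exists w. Qed.

Definition some_set : M := projT1 (cid model_inhabited).

Definition collect Q : M :=
  if pselect (is_set Q) is left h then projT1 (cid h) else some_set.

Lemma mem_collect Q : is_set Q -> forall x, x ∈ collect Q <-> Q x.
Proof.
by rewrite /collect => h; case: pselect => // h' x; case: cid => b /= ->.
Qed.

Lemma setext a b : (forall z, z ∈ a <-> z ∈ b) -> a = b.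
Proof. by apply: (zfc_extensionality Z). Qed.

Lemma is_set_pair x y : is_set (fun z => z = x \/ z = y).
Proof. exact: zfc_pairing Z x y. Qed.

Lemma is_set_Un a : is_set (fun z => exists y, y ∈ a /\ z ∈ y).
Proof. exact: zfc_union Z a. Qed.

Lemma is_set_Pow a : is_set (fun z => subset_in z a).
Proof. exact: zfc_powerset Z a. Qed.

Definition upair x y := collect (fun z => z = x \/ z = y).
Definition sing x := upair x x.
Definition Un a := collect (fun z => exists y, y ∈ a /\ z ∈ y).
Definition cup a b := Un (upair a b).
Definition Pow a := collect (fun z => subset_in z a).
Definition opair x y := upair (sing x) (upair x y).
Definition succ x := cup x (sing x).

Lemma in_upair x y z : z ∈ upair x y <-> z = x \/ z = y.
Proof. exact: mem_collect (is_set_pair x y) z. Qed.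

Lemma in_sing x z : z ∈ sing x <-> z = x.
Proof. by rewrite in_upair; split=> [[]|]; auto. Qed.

Lemma in_Un a z : z ∈ Un a <-> exists y, y ∈ a /\ z ∈ y.
Proof. exact: mem_collect (is_set_Un a) z. Qed.

Lemma in_cup a b z : z ∈ cup a b <-> z ∈ a \/ z ∈ b.
Proof.
rewrite in_Un; split=> [[y [/in_upair[]->]]|[]]; [by left|by right| |] => h.
  by exists a; rewrite in_upair; auto.
by exists b; rewrite in_upair; auto.
Qed.

Lemma in_Pow a z : z ∈ Pow a <-> subset_in z a.
Proof. exact: mem_collect (is_set_Pow a) z. Qed.

Lemma in_succ x z : z ∈ succ x <-> z ∈ x \/ z = x.
Proof. by rewrite in_cup in_sing. Qed.

Lemma is_set_iff P Q : (forall z, P z <-> Q z) -> is_set P -> is_set Q.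
Proof. by move=> PQ [a ha]; exists a => z; rewrite ha. Qed.

Lemma is_opair_opair x y : is_opair x y (opair x y).
Proof. by exists (sing x), (upair x y); split=> z; rewrite in_upair. Qed.

Lemma is_opairP x y p : is_opair x y p <-> p = opair x y.
Proof.
split=> [[s [t [hs ht hp]]]|->]; last exact: is_opair_opair.
apply: setext => z; rewrite hp in_upair.
have -> : s = sing x by apply: setext => w; rewrite hs in_upair.
by have -> : t = upair x y by apply: setext => w; rewrite ht in_upair.
Qed.

Lemma opair_inj x y x' y' : opair x y = opair x' y' -> x = x' /\ y = y'.
Proof.
move=> e.
have ex : x = x'.
  have : sing x' ∈ opair x y by rewrite e in_upair; left.
  rewrite in_upair => -[] h.
    by have := in_sing x x'; rewrite -h in_sing => -[] /(_ erefl).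
  by have := in_upair x y x; rewrite -h in_sing => -[_]; apply; left.
split=> //; rewrite -{}ex {x'} in e.
have [ey|ny] := EM (y = x).
  have : upair x y' ∈ opair x y by rewrite e in_upair; right.
  rewrite ey in_upair => h; have {}h : upair x y' = sing x by case: h.
  by have := in_sing x y'; rewrite -h in_upair => -[h' _]; rewrite h'//; right.
have : upair x y ∈ opair x y' by rewrite -e in_upair; right.
rewrite in_upair => -[] h.
  by have := in_sing x y; rewrite -h in_upair => -[h' _]; case: ny; apply: h'; right.
by have := in_upair x y' y; rewrite -h in_upair => -[h' _]; case: h' => //; right.
Qed.

Lemma rel_ofE (F : set M) x y : rel_of F x y <-> F (opair x y).
Proof.
by split=> [[p [/is_opairP->]]|h]//; exists (opair x y); rewrite is_opairP.
Qed.

Definition app f x y := opair x y ∈ f.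

Lemma foundation a : (exists x, x ∈ a) ->
  exists2 x, x ∈ a & forall z, z ∈ a -> ~ z ∈ x.
Proof.
by move=> /(zfc_foundation Z)[x xa h]; exists x => // z za zx; apply: h za.
Qed.

Lemma mem_irr x : ~ x ∈ x.
Proof.
move=> xx; have [|y /in_sing-> h] := @foundation (sing x).
  by exists x; rewrite in_sing.
by apply: h xx; rewrite in_sing.
Qed.

Lemma mem_asym x y : x ∈ y -> ~ y ∈ x.
Proof.
move=> xy yx; have [|z] := @foundation (upair x y).
  by exists x; rewrite in_upair; left.
by rewrite in_upair => -[]-> h; [apply: h yx|apply: h xy]; rewrite in_upair; auto.
Qed.

Lemma mem_cycle3 x y z : x ∈ y -> y ∈ z -> ~ z ∈ x.
Proof.
move=> xy yz zx; have [|w] := @foundation (cup (upair x y) (sing z)).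
  by exists x; rewrite in_cup in_upair; auto.
rewrite in_cup in_upair in_sing => -[[]|]-> h;
  [apply: h zx|apply: h xy|apply: h yz]; rewrite in_cup in_upair in_sing; auto.
Qed.

Definition transitive_set x := forall y, y ∈ x -> subset_in y x.

(** Foundation yields irreflexivity, transitivity and minimal elements, so only linearity has to be
    checked. *)
Lemma is_ordinalP x : is_ordinal x <-> transitive_set x /\
  forall y z, y ∈ x -> z ∈ x -> [\/ y ∈ z, y = z | z ∈ y].
Proof.
split=> [[tx [_ _ h _]]|[tx h]]; first by split=> // y z /h; apply.
split=> //; split=> //.
- by move=> y _; apply: mem_irr.
- move=> y z w yx zx wx yz zw; case: (h y w) => // [e|wy].
    by rewrite e in yz; case: (mem_asym zw).
  by case: (mem_cycle3 yz zw).
- move=> a ax /foundation[y ya hy]; exists y => // z za.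
  by case: (h y z (ax _ ya) (ax _ za)) => [yz|->|zy]; [right|left|case: (hy _ za)].
Qed.

Lemma ord_trans x y z : is_ordinal x -> y ∈ x -> z ∈ y -> z ∈ x.
Proof. by move=> [tx _] yx; apply: tx. Qed.

Lemma ord_mem x y : is_ordinal x -> y ∈ x -> is_ordinal y.
Proof.
move=> ox yx; have /is_ordinalP[tx h] := ox; apply/is_ordinalP; split.
- move=> z zy w wz; have zx := tx _ yx _ zy; have wx := tx _ zx _ wz.
  case: (h w y) => // [e|yw]; first by rewrite e in wz; case: (mem_asym zy).
  by case: (mem_cycle3 yw wz).
- by move=> z w /(tx _ yx)zx /(tx _ yx); apply: h.
Qed.

Lemma ord_cmp x y : is_ordinal x -> is_ordinal y -> [\/ x ∈ y, x = y | y ∈ x].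
Proof.
(* If [u] is not included in [v], the membership-minimal element of the difference equals the
   intersection of [u] and [v]. *)
have key u v : is_ordinal u -> is_ordinal v -> subset_in u v \/
    exists2 d, d ∈ u & forall z, z ∈ d <-> z ∈ u /\ z ∈ v.
  move=> ou ov; have /is_ordinalP[tu hu] := ou.
  have [h|/existsNP[d0 /not_implyP[d0u d0v]]] := EM (subset_in u v);
    [by left|right].
  have [D hD] := zfc_separation Z (fNot (fMem void 0 1)) (fun=> v) u.
  have [|d /hD[du dv] mind] := @foundation D.
    by exists d0; rewrite hD.
  exists d => // z; split=> [zd|[zu zv]].
    have zu := tu _ du _ zd; split=> //; apply: contrapT => zv.
    by apply: (mind z) zd; rewrite hD.
  case: (hu z d) => // [e|dz]; first by rewrite e in zv; case: dv.
  by case: dv; apply: ord_trans dz.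
move=> ox oy.
have [xy|[d dx hd]] := key x y ox oy; have [yx|[e ey he]] := key y x oy ox.
- by apply: Or32; apply: setext => z; split=> [/xy|/yx].
- apply: Or31; suff <- : e = x by [].
  by apply: setext => z; rewrite he; split=> [[]//|zx]; split=> //; apply: xy.
- apply: Or33; suff <- : d = y by [].
  by apply: setext => z; rewrite hd; split=> [[]//|zy]; split=> //; apply: yx.
(* If both inclusions fail, the intersection belongs to [x] and to [y], hence to itself. *)
- have de : d = e by apply: setext => z; rewrite hd he; split=> -[].
  by case: (@mem_irr d); apply/hd; split=> //; rewrite de.
Qed.

Lemma ord_sub x y : is_ordinal x -> is_ordinal y -> subset_in x y ->
  x = y \/ x ∈ y.
Proof.
move=> ox oy xy; case: (ord_cmp ox oy) => [|->|/xy/mem_irr//]; by auto.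
Qed.

Lemma ord_succ x : is_ordinal x -> is_ordinal (succ x).
Proof.
move=> ox; have /is_ordinalP[tx hx] := ox; apply/is_ordinalP; split.
  move=> y /in_succ yx z zy; apply/in_succ; left; case: yx => [yx|<-//].
  exact: tx zy.
move=> y z /in_succ yx /in_succ zx.
have oy : is_ordinal y by case: yx => [/(ord_mem ox)|->].
have oz : is_ordinal z by case: zx => [/(ord_mem ox)|->].
exact: ord_cmp.
Qed.

Lemma mem_succ x : x ∈ succ x.
Proof. by rewrite in_succ; right. Qed.

Lemma ord_Un a : (forall x, x ∈ a -> is_ordinal x) -> is_ordinal (Un a).
Proof.
move=> h; apply/is_ordinalP; split.
  move=> y /in_Un[x [xa yx]] z zy; apply/in_Un; exists x; split=> //.
  by apply: ord_trans zy; auto.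
move=> y z /in_Un[x [xa yx]] /in_Un[w [wa zw]].
by apply: ord_cmp; [apply: ord_mem yx; auto|apply: ord_mem zw; auto].
Qed.

Lemma ord_bound a : (forall x, x ∈ a -> is_ordinal x) ->
  exists2 b, is_ordinal b & forall x, x ∈ a -> x ∈ b.
Proof.
move=> h; exists (succ (Un a)); first exact/ord_succ/ord_Un.
move=> x xa; apply/in_succ.
case: (ord_cmp (h _ xa) (ord_Un h)) => [|->|Ux]; [by left|by right|].
by case: (@mem_irr (Un a)); apply/in_Un; exists x.
Qed.

End Sets.

(** * Replacement, induction and recursion along the ordinals for definable classes *)

Section Classes.
Context (M : structure) (Z : ZFC M) (X : set (set M)) (XG : GB X).
Implicit Types (a b c f p s t x y z : M) (Q : M -> Prop) (R : M -> M -> Prop).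

Let Xp := comprehensive_params (gb_comprehension XG).
#[local] Hint Resolve Xp : core.

Lemma class_of_dfn1 Q : dfn1 X Q -> X Q.
Proof. by move=> dQ; apply: (gb_comprehension XG (fun=> some_set Z) dQ). Qed.

Lemma dfn_is_upair : dfn3 X (@is_upair M).
Proof. rewrite /is_upair; dfn_tac. Qed.
#[local] Hint Resolve dfn_is_upair : dfn.

Lemma dfn_is_opair : dfn3 X (@is_opair M).
Proof. rewrite /is_opair; dfn_tac. Qed.
#[local] Hint Resolve dfn_is_opair : dfn.

Lemma dfn_rel_of (F : set M) : X F -> dfn2 X (rel_of F).
Proof. by move=> XF; rewrite /rel_of; dfn_tac. Qed.

Lemma dfn_app : dfn3 X (app Z).
Proof.
apply: dfn_iff (_ : dfn X (fun v => exists p, is_opair (v 1) (v 2) p /\ p ∈ v 0)).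
  move=> v; split=> [[p [/(is_opairP Z)->]]//|h].
  by exists (opair Z (v 1) (v 2)); split=> //; apply: is_opair_opair.
dfn_tac.
Qed.

Lemma dfn_subset_in : dfn2 X (@subset_in M).
Proof. rewrite /subset_in; dfn_tac. Qed.
#[local] Hint Resolve dfn_subset_in : dfn.

Lemma dfn_is_ordinal : dfn1 X (@is_ordinal M).
Proof.
apply: dfn_iff (_ : dfn X (fun v => _)) => [v|].
  by symmetry; apply: (is_ordinalP Z).
rewrite /transitive_set.
apply: dfn_and; first by dfn_tac.
apply: (@dfn_iff _ _ (fun v => forall y z, y ∈ v 0 -> z ∈ v 0 ->
  y ∈ z \/ y = z \/ z ∈ y)); last by dfn_tac.
move=> v; split=> h y z yv zv.
  by case: (h y z yv zv) => [|[]]; [apply: Or31|apply: Or32|apply: Or33].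
by case: (h y z yv zv); auto.
Qed.
#[local] Hint Resolve dfn_is_ordinal : dfn.

(** Class replacement is applied to [R] restricted to [a], so [R] has to be functional only
    there. *)
Lemma is_set_image R a : dfn2 X R ->
  (forall x y y', x ∈ a -> R x y -> R x y' -> y = y') ->
  is_set (fun y => exists x, x ∈ a /\ R x y).
Proof.
move=> dR Rfun.
pose F : set M := [set p | exists x y, is_opair x y p /\ (x ∈ a /\ R x y)].
have FE x y : rel_of F x y <-> x ∈ a /\ R x y.
  rewrite (rel_ofE Z); split=> [[x' [y' [/(is_opairP Z) e]]]|h].
    by have [<- <-] := opair_inj e.
  by exists x, y; split=> //; apply: is_opair_opair.
have XF : X F by apply: class_of_dfn1; rewrite /dfn1 /F /=; dfn_tac.
have Ff : class_function F.
  split=> [p [x [y [xyp _]]]|x y y' /FE[xa h] /FE[_]]; first by exists x, y.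
  exact: Rfun.
have [b hb] := gb_class_replacement XG XF Ff a.
exists b => y; rewrite hb; split=> -[x]; first by move=> [xa] /FE[_ r]; exists x.
by move=> [xa r]; exists x; split=> //; apply/FE.
Qed.

Lemma is_set_sep a Q : dfn1 X Q -> is_set (fun x => x ∈ a /\ Q x).
Proof.
move=> dQ; have [||b hb] := @is_set_image (fun x y => y = x /\ Q x) a.
- dfn_tac.
- by move=> x y y' _ [-> _] [->].
by exists b => x; rewrite hb; split=> [[y [ya [-> qy]]]//|[xa qx]]; exists x.
Qed.

Lemma is_set_subset P Q : is_set P -> (forall x, Q x -> P x) -> dfn1 X Q -> is_set Q.
Proof.
move=> [a ha] QP /(is_set_sep a); apply: is_set_iff => x.
by split=> [[]//|qx]; split=> //; apply/ha/QP.
Qed.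

Lemma ords_not_set : ~ is_set (@is_ordinal M).
Proof.
move=> [a ha]; have [b ob hb] := @ord_bound _ Z a (fun x => proj1 (ha x)).
by apply: (@mem_irr _ Z b); apply/hb/ha.
Qed.

(** Definability is essential: the ordinals of [M] need not be well-founded from outside. It turns
    the part of [Q] below [x] into a set, to which foundation applies. *)
Lemma least_ordinal Q : dfn1 X Q -> (exists2 x, is_ordinal x & Q x) ->
  exists2 x, is_ordinal x /\ Q x & forall y, y ∈ x -> ~ Q y.
Proof.
move=> dQ [x ox qx].
have [b hb] := is_set_sep x dQ.
have [nb|nb] := EM (exists y, y ∈ b); last first.
  by exists x => // y yx qy; apply: nb; exists y; rewrite hb.
have [y /hb[yx qy] hy] := foundation Z nb.
exists y; first by split=> //; apply: ord_mem yx.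
by move=> z zy qz; apply: (hy z) => //; rewrite hb; split=> //; apply: ord_trans zy.
Qed.

Lemma ord_ind Q : dfn1 X Q ->
  (forall x, is_ordinal x -> (forall y, y ∈ x -> Q y) -> Q x) ->
  forall x, is_ordinal x -> Q x.
Proof.
move=> dQ IH x ox; apply: contrapT => nq.
have [||y [oy nqy] hy] := @least_ordinal (fun x => ~ Q x); [by apply: dfn_not|by exists x|].
by apply: nqy; apply: IH => // z /hy /contrapT.
Qed.

Section Recursion.
Context (H : M -> M -> M).
Hypothesis dH : dfn3 X (fun x s y => y = H x s).
#[local] Hint Resolve dfn_app : dfn.

Let stage f b y := exists s,
  (forall z, z ∈ s <-> exists c, c ∈ b /\ app Z f c z) /\ y = H b s.

(** Only the behaviour of [f] at arguments up to and including [a] is constrained; the recursion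
    equation then determines its values there. *)
Let approx f a :=
  (forall b, b ∈ a \/ b = a -> exists y, app Z f b y) /\
  (forall b y, b ∈ a \/ b = a -> app Z f b y -> stage f b y).

Let value a y := exists f, approx f a /\ app Z f a y.

Let D_stage : dfn3 X stage.
Proof.
have dH' : dfn3 X (fun x s y => y = H x s) := dH.
rewrite /stage; rewrite /dfn3; apply: dfn_ex; apply: dfn_and; first by dfn_tac.
by apply: (@dfn3_trm _ X Xp (fun x s y => y = H x s)); [|trm_tac..].
Qed.
#[local] Hint Resolve D_stage : dfn.

Let D_approx : dfn2 X approx.
Proof. rewrite /approx; dfn_tac. Qed.
#[local] Hint Resolve D_approx : dfn.

Let D_value : dfn2 X value.
Proof. rewrite /value; dfn_tac. Qed.
#[local] Hint Resolve D_value : dfn.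

Let approx_uniq f f' a a' : is_ordinal a -> is_ordinal a' ->
  approx f a -> approx f' a' -> forall b, is_ordinal b ->
  b ∈ a \/ b = a -> b ∈ a' \/ b = a' ->
  forall y y', app Z f b y -> app Z f' b y' -> y = y'.
Proof.
move=> oa oa' [tf hf] [tf' hf'] b ob.
apply: (@ord_ind (fun b => b ∈ a \/ b = a -> b ∈ a' \/ b = a' ->
  forall y y', app Z f b y -> app Z f' b y' -> y = y')) b ob; first by dfn_tac.
move=> b ob IH ba ba' y y' /(hf _ _ ba)[s [hs ->]] /(hf' _ _ ba')[s' [hs' ->]].
suff -> : s = s' by [].
have dn c d : is_ordinal d -> c ∈ b -> b ∈ d \/ b = d -> c ∈ d \/ c = d.
  by move=> od cb [bd|<-]; left=> //; apply: ord_trans cb.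
apply: (setext Z) => z; rewrite hs hs'; split=> -[c [cb]] fz; exists c; split=> //.
  have [z' fz'] := tf' _ (dn _ _ oa' cb ba').
  by rewrite (IH c cb (dn _ _ oa cb ba) (dn _ _ oa' cb ba') _ _ fz fz').
have [z' fz'] := tf _ (dn _ _ oa cb ba).
by rewrite -(IH c cb (dn _ _ oa cb ba) (dn _ _ oa' cb ba') _ _ fz' fz).
Qed.

Let value_uniq a y y' : is_ordinal a -> value a y -> value a y' -> y = y'.
Proof.
move=> oa [f [hf fy]] [f' [hf' fy']].
by apply: (approx_uniq oa oa hf hf' oa _ _ fy fy'); right.
Qed.

Let approx_sub f a b : is_ordinal a -> b ∈ a -> approx f a -> approx f b.
Proof.
move=> oa ba [t h].
have dn c : c ∈ b \/ c = b -> c ∈ a \/ c = a.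
  by move=> [cb|->]; left=> //; apply: ord_trans cb.
by split=> [c /dn/t|c y /dn]; [|apply: h].
Qed.

Let value_step a : is_ordinal a -> (forall b, b ∈ a -> exists y, value b y) ->
  exists s, (forall z, z ∈ s <-> exists b, b ∈ a /\ value b z) /\
    value a (H a s).
Proof.
move=> oa tot.
have [s hs] : is_set (fun z => exists b, b ∈ a /\ value b z).
  by apply: is_set_image => // b y y' ba; apply/value_uniq/(ord_mem Z oa).
exists s; split=> //.
have [f0 hf0] : is_set (fun p => exists b, b ∈ a /\
    exists y, is_opair b y p /\ value b y).
  apply: is_set_image; first by dfn_tac.
  move=> b p p' ba [y [/(is_opairP Z)-> by_]] [y' [/(is_opairP Z)-> by']].
  by rewrite (value_uniq (ord_mem Z oa ba) by_ by').
pose f := cup Z f0 (sing Z (opair Z a (H a s))).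
have fE b y : app Z f b y <-> (b ∈ a /\ value b y) \/ (b = a /\ y = H a s).
  rewrite /app in_cup hf0 in_sing; split.
    move=> [[b' [ba [y' [/(is_opairP Z) e v]]]]|/opair_inj//]; last by right.
    by left; have [-> ->] := opair_inj e.
  move=> [[ba v]|[-> ->]]; [left|by right].
  by exists b; split=> //; exists y; split=> //; apply: is_opair_opair.
exists f; split; last by apply/fE; right.
have neq c : c ∈ a -> c <> a by move=> ca e; apply: (@mem_irr _ Z a); rewrite -{1}e.
split=> [b [ba|->]|b y ab /fE].
- by have [y v] := tot _ ba; exists y; apply/fE; left.
- by exists (H a s); apply/fE; right.
move=> [[ba [g [ag gy]]]|[-> ->]]; last first.
  exists s; split=> // z; rewrite hs; split=> -[c [ca h]]; exists c; split=> //.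
    by apply/fE; left.
  by case/fE: h => [[]//|[/neq]].
have [_ /(_ b y)] := ag; case; [by right|by []|] => s' [hs' ->].
have ob := ord_mem Z oa ba.
exists s'; split=> // z; rewrite hs'; split=> -[c [cb h]]; exists c; split=> //.
  apply/fE; left; split; first exact: ord_trans cb.
  by exists g; split=> //; apply: approx_sub ag.
have ca : c ∈ a by apply: ord_trans cb.
case/fE: h => [[_ vz]|[/neq]//].
have [z' gz'] : exists z', app Z g c z' by case: ag => t _; apply: t; left.
suff -> : z = z' by [].
apply: value_uniq vz _; first exact: ord_mem ca.
by exists g; split=> //; apply: approx_sub ag.
Qed.

(** The step function receives the set of earlier values rather than the earlier function. The
    values are read off from set-sized approximations, which agree by induction and extend by
    [value_step]. *)
Lemma recursion : exists F : M -> M,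
  dfn2 X (fun x y => is_ordinal x /\ y = F x) /\
  forall x s, is_ordinal x -> (forall z, z ∈ s <-> exists y, y ∈ x /\ z = F y) ->
    F x = H x s.
Proof.
have tot a : is_ordinal a -> exists y, value a y.
  move=> oa; apply: (@ord_ind (fun a => exists y, value a y)) oa; first by dfn_tac.
  by move=> x ox /(value_step ox)[s [_ v]]; exists (H x s).
pose F a := if pselect (exists y, value a y) is left h then projT1 (cid h)
  else some_set Z.
have FE a y : is_ordinal a -> value a y <-> y = F a.
  move=> oa; rewrite /F; case: pselect => [h|/(_ (tot _ oa))//].
  case: cid => z /= v; split=> [v'|->//]; exact: value_uniq v' v.
exists F; split.
  apply: dfn_iff (_ : dfn X (fun v => is_ordinal (v 0) /\ value (v 0) (v 1))).
    by move=> v; split=> -[oa]; move/(FE _ _ oa).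
  dfn_tac.
move=> x s ox hs; symmetry; apply/FE => //.
have [|s' [hs' v]] := value_step ox; first by move=> b bx; apply/tot/(ord_mem Z ox).
suff -> : s = s' by [].
apply: (setext Z) => z; rewrite hs hs'.
by split=> -[b [bx e]]; exists b; split=> //; apply/FE => //; apply: ord_mem bx.
Qed.

End Recursion.

(** The form used for choices that may run out: where [Q] offers no value the recursion continues
    with a default, so [Q] is asserted only where it can be satisfied. *)
Lemma recursion_rel (Q : M -> M -> M -> Prop) : dfn3 X Q ->
  (forall x s y y', Q x s y -> Q x s y' -> y = y') ->
  exists F : M -> M,
  dfn2 X (fun x y => is_ordinal x /\ y = F x) /\
  forall x, is_ordinal x -> exists2 s,
    forall z, z ∈ s <-> exists y, y ∈ x /\ z = F y &
    (exists y, Q x s y) -> Q x s (F x).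
Proof.
move=> dQ Qfun.
pose H x s := if pselect (exists y, Q x s y) is left h then projT1 (cid h)
  else some_set Z.
have HE x s y : y = H x s <-> Q x s y \/ ((~ exists y, Q x s y) /\ y = some_set Z).
  rewrite /H; case: pselect => [h|n]; last first.
    by split=> [->|[q|[]//]]; [right|case: n; exists y].
  case: cid => z /= q; split=> [->|[q'|[]//]]; [by left|exact: Qfun q' q].
have [|F [dF hF]] := @recursion H.
  by apply: dfn_iff (fun v => iff_sym (HE _ _ _)) _; dfn_tac.
exists F; split=> // x ox.
have [s hs] : is_set (fun z => exists y, y ∈ x /\ (is_ordinal y /\ z = F y)).
  by apply: is_set_image => // y z z' _ [_ ->] [].
have {}hs z : z ∈ s <-> exists y, y ∈ x /\ z = F y.
  rewrite hs; split=> -[y [yx]]; first by move=> [_ ->]; exists y.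
  by move=> ->; exists y; split=> //; split=> //; apply: ord_mem yx.
exists s => // ex; rewrite (hF x s ox hs) /H.
by case: pselect => // h; case: cid.
Qed.

End Classes.
#[global] Hint Resolve dfn_is_upair dfn_is_opair dfn_rel_of dfn_app
  dfn_subset_in dfn_is_ordinal : dfn.

(** * The cumulative hierarchy and ranks *)

Section Hierarchy.
Context (M : structure) (Z : ZFC M) (X : set (set M)) (XG : GB X).
Implicit Types (a b c f p s t u x y z : M) (Q : M -> Prop) (R : M -> M -> Prop).

Let Xp := comprehensive_params (gb_comprehension XG).
#[local] Hint Resolve Xp : core.

Lemma cumulative_hierarchy : exists V : M -> M,
  dfn2 X (fun z x => is_ordinal x /\ z ∈ V x) /\
  forall x, is_ordinal x -> forall z, z ∈ V x <-> exists y, y ∈ x /\ subset_in z (V y).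
Proof.
pose Q (x s y : M) := forall z, z ∈ y <-> exists u, u ∈ s /\ subset_in z u.
have [||V [dV hV]] := @recursion_rel _ Z _ XG Q.
- rewrite /Q; dfn_tac.
- by move=> x s y y' h h'; apply: (setext Z) => z; rewrite h h'.
have dV' : dfn2 X (fun x y => is_ordinal x /\ y = V x) := dV.
exists V; split.
  apply: (@dfn_iff _ _ (fun v => exists y, (is_ordinal (v 1) /\ y = V (v 1)) /\ v 0 ∈ y)).
    move=> v; split=> [[y [[o ->]]]|[o h]]; [by []|by exists (V (v 1))].
  apply: dfn_ex; apply: dfn_and; last by dfn_tac.
  by apply: (dfn2_trm Xp dV'); trm_tac.
move=> x ox z; have [s hs h] := hV x ox.
have {h}-> : z ∈ V x <-> exists u, u ∈ s /\ subset_in z u.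
  apply: h; apply: (is_set_subset (X := X) Z XG (is_set_Pow Z (Un Z s))).
    by move=> y [u [us yu]] w /yu wu; apply/in_Un; exists u.
  by dfn_tac.
by split=> [[u [/hs[y [yx ->]] zu]]|[y [yx zy]]];
  [exists y|exists (V y); split=> //; apply/hs; exists y].
Qed.

Lemma limit_ordinal : exists2 l, is_ordinal l &
  (exists x, x ∈ l /\ forall z, ~ z ∈ x) /\ forall x, x ∈ l -> succ Z x ∈ l.
Proof.
have [w [[o ow o0] wS]] := zfc_infinity Z.
have [L hL] := is_set_sep (X := X) Z XG w (dfn_is_ordinal (X := X) Z XG).
have oo : is_ordinal o by apply/(is_ordinalP Z); split=> [y /o0|y z /o0].
have LS x : x ∈ L -> succ Z x ∈ L.
  move=> /hL[xw ox]; apply/hL; split; last exact: ord_succ.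
  have [s sw hs] := wS _ xw; suff <- : s = succ Z x by [].
  by apply: (setext Z) => z; rewrite hs in_succ.
have oL : o ∈ L by apply/hL.
exists (Un Z L); first by apply: ord_Un => x /hL[].
split; first by exists o; split=> //; apply/in_Un; exists (succ Z o); split;
  [exact: LS|exact: mem_succ].
move=> x /in_Un[y [yL xy]]; apply/in_Un; exists (succ Z y); split; first exact: LS.
have /hL[_ oy] := yL; have ox := ord_mem Z oy xy.
apply/in_succ; case: (ord_sub Z (ord_succ Z ox) oy); [|by right|by left].
by move=> z /in_succ[zx|->//]; apply: ord_trans zx.
Qed.
End Hierarchy.

Section Ranks.
Context (M : structure) (Z : ZFC M) (X : set (set M)) (XG : GB X) (V : M -> M).
Hypothesis dV : dfn2 X (fun z x => is_ordinal x /\ z ∈ V x).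
Hypothesis hV : forall x, is_ordinal x ->
  forall z, z ∈ V x <-> exists y, y ∈ x /\ subset_in z (V y).
Implicit Types (a b c f p s t u x y z : M) (Q : M -> Prop) (R : M -> M -> Prop).

Let Xp := comprehensive_params (gb_comprehension XG).
#[local] Hint Resolve Xp : core.
Let set_image := @is_set_image M Z X XG.
Let set_sep := @is_set_sep M Z X XG.

Definition has_rank z x := is_ordinal x /\ z ∈ V x.
#[local] Hint Extern 0 (dfn2 _ has_rank) => exact: dV : dfn.

Lemma V_mono x y z : is_ordinal x -> y ∈ x -> z ∈ V y -> z ∈ V x.
Proof.
move=> ox yx; have oy := ord_mem Z ox yx.
move=> /(hV oy)[w [wy zw]]; apply/(hV ox); exists w; split=> //.
exact: ord_trans wy.
Qed.

(** Collection by least witnesses: for each [x] in [a] the least ordinal is unique, so these form a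
    set, and monotonicity lifts all of them to one bound. *)
Lemma uniform_ordinal R a : dfn2 X R ->
  (forall x r r', x ∈ a -> is_ordinal r' -> r ∈ r' -> R x r -> R x r') ->
  (forall x, x ∈ a -> exists2 r, is_ordinal r & R x r) ->
  exists2 r, is_ordinal r & forall x, x ∈ a -> R x r.
Proof.
move=> dR Rmono Rex.
pose S x r := (is_ordinal r /\ R x r) /\ forall q, q ∈ r -> ~ R x q.
have dS : dfn2 X S by rewrite /S; dfn_tac.
have Sfun x r r' : S x r -> S x r' -> r = r'.
  move=> [[o rr] h] [[o' rr'] h']; case: (ord_cmp Z o o') => //.
    by move=> /h'.
  by move=> /h.
have [b hb] : is_set (fun r => exists x, x ∈ a /\ S x r).
  by apply: set_image => // x r r' _; apply: Sfun.
have [|r or hr] := ord_bound Z (a := b).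
  by move=> r /hb[x [_ [[]]]].
exists r => // x xa.
have [||q [oq rq] hq] := @least_ordinal _ Z X XG (R x).
- by apply: (dfn2_trm Xp dR); trm_tac.
- by have [q] := Rex x xa; exists q.
apply: (Rmono x q) => //; apply/hr/hb; exists x; split=> //.
Qed.

Lemma rank_step z : (forall y, y ∈ z -> exists x, has_rank y x) ->
  exists x, has_rank z x.
Proof.
move=> h; have [||r or hr] := @uniform_ordinal has_rank z dV.
- by move=> y r r' _ or' rr' [_ yr]; split=> //; apply: V_mono yr.
- by move=> y /h[r [or yr]]; exists r.
exists (succ Z r); split; first exact: ord_succ.
apply/hV; first exact: ord_succ.
by exists r; split; [exact: mem_succ|move=> y /hr[]].
Qed.

Lemma rank_exists z : exists x, has_rank z x.
Proof.
apply: contrapT => nz.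
have [l ol [[o [lo o0]] lS]] := limit_ordinal Z XG.
(* The union of the values [F x] with [x] in the limit ordinal [l] is a transitive set that includes
   [z]. *)
have [|F [dF hF]] := @recursion _ Z X XG (fun _ s => cup Z z (Un Z (Un Z s))).
  apply: (@dfn_iff _ _ (fun v => forall y, y ∈ v 2 <->
    y ∈ z \/ exists u, (exists t, t ∈ v 1 /\ u ∈ t) /\ y ∈ u)); last by dfn_tac.
  move=> v; split=> [h|->].
    apply: (setext Z) => y; rewrite h in_cup in_Un.
    by split=> -[]; auto; move=> [u [ut yu]]; right; exists u; move: ut; rewrite in_Un.
  move=> y; rewrite in_cup in_Un.
  by split=> -[]; auto; move=> [u [ut yu]]; right; exists u; move: ut; rewrite in_Un.
have dF' : dfn2 X (fun x y => is_ordinal x /\ y = F x) := dF.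
have Fset x : is_ordinal x -> is_set (fun y => exists w, w ∈ x /\ y = F w).
  move=> ox; apply: is_set_iff (_ : is_set (fun y => exists w, w ∈ x /\
    (is_ordinal w /\ y = F w))).
    move=> y; split=> -[w [wx]]; first by move=> [_ ->]; exists w.
    by move=> ->; exists w; split=> //; split=> //; apply: ord_mem wx.
  by apply: set_image => // w y y' _ [_ ->] [].
have FE x y : is_ordinal x -> y ∈ F x <-> y ∈ z \/ exists w, w ∈ x /\
    exists u, u ∈ F w /\ y ∈ u.
  move=> ox; have [s hs] := Fset x ox.
  rewrite (hF x s ox hs) in_cup in_Un; split=> -[]; auto => -[].
    move=> u [/in_Un[t [/hs[w [wx ->]] ut]] yu].
    by right; exists w; split=> //; exists u.
  move=> w [wx [u [uw yu]]]; right; exists u; split=> //.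
  by apply/in_Un; exists (F w); split=> //; apply/hs; exists w.
have [U hU] := Fset l ol.
(* A minimal element of [A] has only ranked elements, because they occur one step later in the same
   transitive set; [rank_step] then gives it a rank. *)
have [A hA] : is_set (fun y => y ∈ Un Z U /\ ~ exists x, has_rank y x).
  apply: set_sep => //; dfn_tac.
have [|y /hA[/in_Un[t [/hU[w [wl ->]] yw]] ny] hy] := foundation Z (a := A).
  apply: contrapT => nA; apply: nz; apply: rank_step => y yz; apply: contrapT => ny.
  apply: nA; exists y; apply/hA; split=> //; apply/in_Un; exists (F o).
  split; first by apply/hU; exists o.
  by apply/FE; [exact: ord_mem lo|left].
apply: ny; apply: rank_step => x xy; apply: contrapT => nx.
apply: (hy x) => //; apply/hA; split=> //; apply/in_Un; exists (F (succ Z w)).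
split; first by apply/hU; exists (succ Z w); split=> //; apply: lS.
have ow := ord_mem Z ol wl.
apply/FE; first exact: ord_succ.
by right; exists w; split; [exact: mem_succ|exists y].
Qed.

End Ranks.

(** * Choice for sets and distributivity of the forcing *)

Section Distributivity.
Context (M : structure) (Z : ZFC M) (X : set (set M)) (XG : GB X).
Implicit Types (a b c f p q r s t u x y z : M) (R : M -> M -> Prop).

Let Xp := comprehensive_params (gb_comprehension XG).
#[local] Hint Resolve Xp : core.
Let set_image := @is_set_image M Z X XG.
Let set_sep := @is_set_sep M Z X XG.

Lemma choice_function b : exists c, forall u, subset_in u b ->
  (exists z, z ∈ u) -> exists! z, z ∈ u /\ app Z c u z.
Proof.
(* Pairing the elements of [u] with [u] itself makes the family disjoint, as [zfc_choice]
   demands. *)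
pose tagged u p := forall w, w ∈ p <-> exists z, z ∈ u /\ is_opair u z w.
have dt : dfn2 X tagged by rewrite /tagged; dfn_tac.
have tag_ex u : exists p, tagged u p.
  have [||p hp] := @set_image (fun z w => is_opair u z w) u; first by dfn_tac.
    by move=> z w w' _ /(is_opairP Z)-> /(is_opairP Z).
  by exists p.
have tag_fun u p p' : tagged u p -> tagged u p' -> p = p'.
  by move=> h h'; apply: (setext Z) => w; rewrite h h'.
have [P hP] : is_set (fun p => exists u, u ∈ Pow Z b /\
    ((exists z, z ∈ u) /\ tagged u p)).
  apply: set_image; first by dfn_tac.
  by move=> u p p' _ [_ h] [_]; apply: tag_fun h.
have [||c hc] := zfc_choice Z (a := P).
- move=> p /hP[u [_ [[z zu] h]]]; exists (opair Z u z); apply/h.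
  by exists z; split=> //; apply: is_opair_opair.
- move=> p p' w /hP[u [_ [_ h]]] /hP[u' [_ [_ h']]] /h[z [_ e]] /h'[z' [_ e']].
  move/(is_opairP Z): e e' => -> /(is_opairP Z) /opair_inj[e _].
  by apply: (tag_fun u) => //; rewrite e.
exists c => u ub [z0 z0u]; have [p tp] := tag_ex u.
have [|w [[/tp[z [zu /(is_opairP Z) ew]] wc] uw]] := hc p.
  by apply/hP; exists u; split; [apply/in_Pow|split=> //; exists z0].
exists z; split; first by split=> //; rewrite /app -ew.
move=> z' [z'u ap]; have := uw (opair Z u z').
rewrite ew => h; suff /opair_inj[] : opair Z u z = opair Z u z' by [].
apply: h; split=> //; apply/tp; exists z'; split=> //; exact: is_opair_opair.
Qed.

(** Replacement along the inverse of [F] would turn the class of all ordinals into a set. *)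
Lemma no_ordinal_injection (F : M -> M) a :
  dfn2 X (fun x y => is_ordinal x /\ y = F x) ->
  (forall x, is_ordinal x -> F x ∈ a) ->
  (forall x y, is_ordinal x -> y ∈ x -> F y <> F x) -> False.
Proof.
move=> dF Fa Finj; apply: (ords_not_set Z).
have dF' : dfn2 X (fun y x => is_ordinal x /\ y = F x).
  by apply: (dfn2_trm Xp dF); trm_tac.
apply: is_set_iff (_ : is_set (fun x => exists y, y ∈ a /\ (is_ordinal x /\ y = F x))).
  by move=> x; split=> [[y [_ []]]|ox] //; exists (F x); split=> //; apply: Fa.
apply: set_image => // y x x' _ [ox ->] [ox' e].
by case: (ord_cmp Z ox ox') => // h; [case: (Finj x' x)|case: (Finj x x')].
Qed.

Lemma set_image_fun (F : M -> M) x : dfn2 X (fun x y => is_ordinal x /\ y = F x) ->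
  is_ordinal x -> is_set (fun z => exists y, y ∈ x /\ z = F y).
Proof.
move=> dF ox.
have [s hs] : is_set (fun z => exists y, y ∈ x /\ (is_ordinal y /\ z = F y)).
  by apply: set_image => // y z z' _ [_ ->] [].
exists s => z; rewrite hs; split=> -[y [yx]]; first by move=> [_ ->]; exists y.
by move=> ->; exists y; split=> //; split=> //; apply: ord_mem yx.
Qed.

(** Zermelo's argument: keep choosing from the rest of [a]. If [a] were never exhausted, the choices
    would inject the ordinals into [a]. *)
Lemma enumeration a : exists k F, [/\ is_ordinal k,
  dfn2 X (fun x y => is_ordinal x /\ y = F x) &
  forall x, x ∈ a -> exists2 y, y ∈ k & x = F y].
Proof.
have [c hc] := choice_function a.
pose rest s u := forall z, z ∈ u <-> z ∈ a /\ ~ z ∈ s.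
pose Q (x s y : M) := exists u, rest s u /\ (y ∈ u /\ app Z c u y).
have rest_fun s u u' : rest s u -> rest s u' -> u = u'.
  by move=> h h'; apply: (setext Z) => z; rewrite h h'.
have [||F [dF hF]] := @recursion_rel _ Z _ XG Q.
- rewrite /Q /rest; dfn_tac.
- move=> x s y y' [u [hu [yu cy]]] [u' [hu' [yu' cy']]].
  move: yu' cy'; rewrite -(rest_fun _ _ _ hu hu') => yu' cy'.
  have [|w [_ uw]] := hc u _ (ex_intro _ y yu); first by move=> z /hu[].
  by rewrite -(uw y)// -(uw y').
suff [k ok hk] : exists2 k, is_ordinal k &
    forall x, x ∈ a -> exists2 y, y ∈ k & x = F y by exists k, F; split.
apply: contrapT => nk.
have key x s : is_ordinal x -> (forall z, z ∈ s <-> exists y, y ∈ x /\ z = F y) ->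
    exists y, Q x s y.
  move=> ox hs; apply: contrapT => nQ; apply: nk; exists x => // z za.
  apply: contrapT => nz.
  have [u hu] := set_sep a (Q := fun z => ~ z ∈ s) ltac:(dfn_tac).
  have zu : z ∈ u by apply/hu; split=> // /hs[y [yx e]]; apply: nz; exists y.
  have [|w [[wu cw] _]] := hc u _ (ex_intro _ z zu); first by move=> w /hu[].
  by apply: nQ; exists w, u.
have Fa x : is_ordinal x -> F x ∈ a /\ forall y, y ∈ x -> F y <> F x.
  move=> ox; have [s hs /(_ (key x s ox hs))[u [hu [/hu[Fa Fs] _]]]] := hF x ox.
  by split=> // y yx e; apply: Fs; apply/hs; exists y.
apply: (@no_ordinal_injection F a) => // [x /Fa[]//|x y ox yx].
by have [_] := Fa x ox; apply.
Qed.

Record set_closed_forcing (Q : M -> Prop) (le : M -> M -> Prop) : Prop := {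
  forcing_dfn : dfn1 X Q;
  forcing_dfn_le : dfn2 X le;
  forcing_refl : forall p, Q p -> le p p;
  forcing_trans : forall p q r, Q p -> Q q -> Q r -> le p q -> le q r -> le p r;
  forcing_chain : forall t, (forall p, p ∈ t -> Q p) ->
    (forall p q, p ∈ t -> q ∈ t -> le p q \/ le q p) ->
    exists2 r, Q r & forall p, p ∈ t -> le r p }.

Section Dense.
Context (Q : M -> Prop) (le : M -> M -> Prop) (QF : set_closed_forcing Q le).
Context (D : M -> M -> Prop) (a : M).
Hypothesis dD : dfn2 X D.
Hypothesis D_dense : forall x, x ∈ a -> forall p, Q p ->
  exists2 q, Q q /\ le q p & D x q.
Hypothesis D_open : forall x p q, x ∈ a -> Q p -> Q q -> le q p -> D x p -> D x q.

(* Enumerate [a] in order type [k] and reflect the dense classes to an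
   increasing sequence [T] of sets, so that the axiom of choice for sets
   is enough to build a descending sequence of conditions of length [k]. *)
Lemma distributive c : Q c -> exists2 q, Q q /\ le q c & forall x, x ∈ a -> D x q.
Proof.
move=> Qc.
have dQ := forcing_dfn QF; have dle := forcing_dfn_le QF.
have [k [e [ok de he]]] := enumeration a.
(* The requirement on a next condition after the choices in [t]. The guard [x ∈ a] is there because
   [e] may take values outside [a]. *)
pose E t x q := Q q /\ ((forall p, p ∈ t -> le q p) /\
  (le q c /\ (x ∈ a -> D x q))).
have dE : dfn3 X E by rewrite /E; dfn_tac.
have [V [dV hV]] := cumulative_hierarchy Z XG.
have dV' : dfn2 X (has_rank V) := dV.
have [a' ha'] := set_image_fun de ok.
(* The level [r] contains all earlier levels and a next condition for every set of choices made
   inside them, whenever one exists at all. *)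
pose bound s r := is_ordinal r /\ ((forall u, u ∈ s -> forall z, z ∈ u -> has_rank V z r) /\
  forall t, (forall z, z ∈ t -> exists u, u ∈ s /\ z ∈ u) ->
  forall x, x ∈ a' -> (exists q, E t x q) -> exists q, has_rank V q r /\ E t x q).
have db : dfn2 X bound by rewrite /bound; dfn_tac.
have bound_ex s : exists2 r, is_ordinal r & bound s r.
  have rmono z r r' : is_ordinal r' -> r ∈ r' -> has_rank V z r -> has_rank V z r'.
    by move=> or' rr' [_ zr]; split=> //; apply: (V_mono Z hV) zr.
  pose hits t x r := (exists q, E t x q) -> exists q, has_rank V q r /\ E t x q.
  have dh : dfn3 X hits by rewrite /hits; dfn_tac.
  have hmono t x r r' : is_ordinal r' -> r ∈ r' -> hits t x r -> hits t x r'.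
    by move=> or' rr' h /h[q [qr Eq]]; exists q; split=> //; apply: rmono qr.
  have [r1 or1 hr1] : exists2 r, is_ordinal r & forall z, z ∈ Un Z s -> has_rank V z r.
    apply: (uniform_ordinal Z XG dV') => [z r r' _|z _]; first exact: rmono.
    by have [r [or zr]] := rank_exists Z XG dV hV z; exists r.
  have [r2 or2 hr2] : exists2 r, is_ordinal r &
      forall t, t ∈ Pow Z (Un Z s) -> forall x, x ∈ a' -> hits t x r.
    apply: (uniform_ordinal Z XG).
    + by dfn_tac.
    + by move=> t r r' _ or' rr' h x xa; apply: hmono (h x xa).
    + move=> t _; apply: (uniform_ordinal Z XG).
      * by dfn_tac.
      * by move=> x r r' _; apply: hmono.
      * move=> x _; case: (EM (exists q, E t x q)) => [[q Eq]|n].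
          have [r [or qr]] := rank_exists Z XG dV hV q.
          by exists r => // _; exists q.
        by exists k => // /n.
  have [r or hr] : exists2 r, is_ordinal r & r1 ∈ r /\ r2 ∈ r.
    have [|b ob hb] := ord_bound Z (a := upair Z r1 r2).
      by move=> x /in_upair[]->.
    by exists b => //; split; apply: hb; apply/in_upair; auto.
  exists r => //; split=> //; split.
    move=> u us z zu; apply: (rmono z r1) => //; first by case: hr.
    by apply: hr1; apply/in_Un; exists u.
  move=> t ts x xa; apply: (hmono t x r2) => //; first by case: hr.
  by apply: hr2 => //; apply/in_Pow => z /ts h; apply/in_Un.
pose QT (x s y : M) := exists r, (bound s r /\ forall r', r' ∈ r -> ~ bound s r') /\
  forall z, z ∈ y <-> has_rank V z r.
have [||T [dT hT]] := @recursion_rel _ Z _ XG QT.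
- rewrite /QT; dfn_tac.
- move=> x s y y' [r [[hb hr] hy]] [r' [[hb' hr'] hy']].
  apply: (setext Z) => z; rewrite hy hy'; suff -> : r = r' by [].
  case: (ord_cmp Z (proj1 hb) (proj1 hb')) => //; [by move=> /hr'|by move=> /hr].
have QT_ex x s : exists y, QT x s y.
  have [||r [or br] hr] := @least_ordinal _ Z X XG (bound s); [by dfn_tac|exact: bound_ex|].
  exists (V r), r; split=> // z; by split=> [|[]].
have {}hT x : is_ordinal x -> exists2 s, forall z, z ∈ s <-> exists y, y ∈ x /\ z = T y &
    (forall u, u ∈ s -> subset_in u (T x)) /\
    forall t, (forall z, z ∈ t -> exists u, u ∈ s /\ z ∈ u) ->
    forall w, w ∈ a' -> (exists q, E t w q) -> exists q, q ∈ T x /\ E t w q.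
  move=> /hT[s hs /(_ (QT_ex _ _))[r [[[or [b1 b2]] _] h]]]; exists s => //; split.
    by move=> u us z zu; apply/h; apply: b1 zu.
  by move=> t ts w wa /(b2 t ts w wa)[q [qr Eq]]; exists q; split=> //; apply/h.
have dT' : dfn2 X (fun x y => is_ordinal x /\ y = T x) := dT.
have [TT hTT] := set_image_fun dT ok.
have [ch hch] := choice_function (Un Z TT).
pose Tr x y := is_ordinal x /\ y = T x.
pose er x y := is_ordinal x /\ y = e x.
have dTr : dfn2 X Tr := dT.
have der : dfn2 X er := de.
(* The candidates at stage [x]. The bound by [k] keeps every candidate set inside the single set
   [Un Z TT], so the one choice function [ch] serves all stages. *)
pose elig x s u := x ∈ k /\ forall q, q ∈ u <->
  (exists y, Tr x y /\ q ∈ y) /\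
  exists w, er x w /\ E s w q.
have delig : dfn3 X elig.
  rewrite /elig; dfn_tac.
have elig_fun x s u u' : elig x s u -> elig x s u' -> u = u'.
  by move=> [_ h] [_ h']; apply: (setext Z) => z; rewrite h h'.
have elig_sub x s u : elig x s u -> subset_in u (Un Z TT).
  move=> [xk h] q /h[[y [[_ ->] qT]] _]; apply/in_Un; exists (T x).
  by split=> //; apply/hTT; exists x.
pose QR x s y := exists u, elig x s u /\ (y ∈ u /\ app Z ch u y).
have [||R [dR hR]] := @recursion_rel _ Z _ XG QR.
- rewrite /QR; dfn_tac.
- move=> x s y y' [u [hu [yu cy]]] [u' [hu' [yu' cy']]].
  move: yu' cy'; rewrite -(elig_fun _ _ _ _ hu hu') => yu' cy'.
  have [|w [_ uw]] := hch u _ (ex_intro _ y yu); first exact: elig_sub hu.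
  by rewrite -(uw y)// -(uw y').
pose Rr x y := is_ordinal x /\ y = R x.
have dRr : dfn2 X Rr := dR.
pose good x := x ∈ k -> exists s,
  (forall z, z ∈ s <-> exists w, w ∈ x /\ Rr w z) /\
  exists y, Rr x y /\ ((exists v, Tr x v /\ y ∈ v) /\
    exists w, er x w /\ E s w y).
have dgood : dfn1 X good.
  rewrite /good; dfn_tac.
have chain (A : M -> Prop) (t : M) : (forall z, z ∈ t <-> exists w, A w /\ z = R w) ->
    (forall w, A w -> [/\ is_ordinal w, Q (R w), le (R w) c &
      forall v, v ∈ w -> A v -> le (R w) (R v)]) ->
    exists2 r, Q r & (forall p, p ∈ t -> le r p) /\ le r c.
  (* Including [c] in the chain keeps the lower bound below [c] even when [t] is empty. *)
  move=> ht hA; have [||r Qr hr] := forcing_chain QF (t := cup Z t (sing Z c)).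
  - move=> p /in_cup[/ht[w [/hA[_ Qw _ _] ->]]//|/in_sing->//].
  - move=> p q /in_cup[/ht[w [Aw ->]]|/in_sing->] /in_cup[/ht[v [Av ->]]|/in_sing->].
    + have [ow Qw _ hw] := hA _ Aw; have [ov Qv _ hv] := hA _ Av.
      case: (ord_cmp Z ow ov) => [wv|->|vw]; [by right; apply: hv| |by left; apply: hw].
      by left; apply: (forcing_refl QF).
    + by left; case: (hA _ Aw).
    + by right; case: (hA _ Av).
    + by left; apply: (forcing_refl QF).
  - exists r => //; split; last by apply: hr; apply/in_cup; right; apply/in_sing.
    by move=> p pt; apply: hr; apply/in_cup; left.
have gd x : is_ordinal x -> good x.
  apply: (ord_ind Z XG) dgood _ x => x ox IH xk.
  have [s hs] := set_image_fun dR ox.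
  have hs' z : z ∈ s <-> exists w, w ∈ x /\ Rr w z.
    rewrite hs; split=> -[w [wx]]; last by move=> [_ ->]; exists w.
    by move=> ->; exists w; split=> //; split=> //; apply: ord_mem wx.
  exists s; split=> //; exists (R x); split=> //.
  have IHw w : w ∈ x -> [/\ is_ordinal w, Q (R w), le (R w) c & R w ∈ T w] /\
      forall v, v ∈ w -> le (R w) (R v).
    move=> wx; have wk : w ∈ k by apply: ord_trans wx.
    have ow := ord_mem Z ox wx.
    have [s' [hs'' [y [[_ ->] [[v [[_ ->] RT]] [w' [_ [Qy [yl [yc _]]]]]]]]]] := IH w wx wk.
    split=> // v' v'w; apply: yl; apply/hs''; exists v'; split=> //.
    by split=> //; apply: ord_mem v'w.
  have [ss hss [TT1 TT2]] := hT x ox.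
  have [|r Qr [rs rc]] := chain (fun w => w ∈ x) s hs.
    by move=> w /IHw[[ow Qw wc _] h]; split=> // v /h.
  have [q Eq] : exists q, E s (e x) q.
    have [xa|nxa] := EM (e x ∈ a); last first.
      by exists r; split=> //; split=> //; split=> // /nxa.
    have [q [Qq qr] Dq] := D_dense xa Qr.
    exists q; split=> //; split; last by split=> //; apply: (forcing_trans QF) qr rc.
    move=> p ps; apply: (forcing_trans QF) qr (rs p ps) => //.
    by move/hs: ps => [w [/IHw[[_ Qw _ _] _] ->]].
  (* The earlier choices lie in earlier levels, so the candidate [q], which may have any rank, can
     be replaced by one in [T x]. *)
  have [|||q' [q'T Eq']] := TT2 s _ (e x).
  - move=> z /hs[w [wx ->]]; exists (T w); split; last by case: (IHw w wx) => -[].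
    by apply/hss; exists w.
  - by apply/ha'; exists x.
  - by exists q.
  have [s0 hs0 hR0] := hR x ox.
  have es0 : s0 = s by apply: (setext Z) => z; rewrite hs0 hs.
  rewrite es0 in hR0.
  have [u hu] : exists u, elig x s u.
    have [u hu] := set_sep (T x) (Q := fun q => E s (e x) q) ltac:(dfn_tac).
    exists u; split=> // z; rewrite hu; split=> [[zT Ez]|[[y [[_ ->] zT]] [w [[_ ->] Ez]]]//].
    by split; [exists (T x)|exists (e x)].
  have q'u : q' ∈ u.
    by case: hu => _ hu; apply/hu; split; [exists (T x)|exists (e x)].
  have [w [[wu cw] _]] := hch u (elig_sub _ _ _ hu) (ex_intro _ q' q'u).
  have [u' [[_ hu'] [/hu'[h1 h2] _]]] : QR x s (R x) by apply: hR0; exists w, u.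
  by split.
have [S hS] := set_image_fun dR ok.
have good_k w : w ∈ k -> [/\ is_ordinal w, Q (R w), le (R w) c &
    forall v, v ∈ w -> v ∈ k -> le (R w) (R v)] /\ (e w ∈ a -> D (e w) (R w)).
  move=> wk; have ow := ord_mem Z ok wk.
  have [s' [hs'' [y [[_ ->] [_ [w' [[_ ->] [Qy [yl [yc yD]]]]]]]]]] := gd w ow wk.
  split=> //; split=> // v vw _; apply: yl; apply/hs''; exists v; split=> //.
  by split=> //; apply: ord_mem vw.
have [|r Qr [rS rc]] := chain (fun w => w ∈ k) S hS.
  by move=> w /good_k[].
exists r; first by split.
move=> x xa; have [w wk ex] := he x xa.
have [[_ Qw _ _] Dw] := good_k w wk.
apply: (D_open (p := R w)) => //; first by apply: rS; apply/hS; exists w.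
by rewrite ex; apply: Dw; rewrite -ex.
Qed.
End Dense.
End Distributivity.

(** * Forcing without new sets *)

Section Forcing.
Context (M : structure) (Z : ZFC M) (X : set (set M)) (XG : GB X).
Context (Q : M -> Prop) (le : M -> M -> Prop) (QF : set_closed_forcing X Q le).
Implicit Types (v : nat -> M) (R : (nat -> M) -> Prop) (a b c p q r x y z : M).

Let Xp := comprehensive_params (gb_comprehension XG).
#[local] Hint Resolve Xp : core.
Let dQ : dfn1 X Q := forcing_dfn QF.
Let dle : dfn2 X le := forcing_dfn_le QF.

Record generic_filter (G : M -> Prop) : Prop := {
  generic_sub : forall p, G p -> Q p;
  generic_nonempty : exists p, G p;
  generic_directed : forall p q, G p -> G q -> exists2 r, G r & le r p /\ le r q;
  generic_up : forall p q, G p -> Q q -> le p q -> G q;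
  generic_meet : forall D : M -> Prop, dfn1 X D ->
    (forall p, Q p -> exists2 q, Q q /\ le q p & D q) -> exists2 p, G p & D p }.

Context (G : M -> Prop) (GG : generic_filter G).
Context (I : Type) (N : I -> M -> M -> Prop).
Hypothesis dN : forall i, dfn2 X (N i).
Hypothesis N_mono : forall i p q x, Q p -> Q q -> le q p -> N i p x -> N i q x.

Definition realize (i : I) : set M := [set x | exists2 p, G p & N i p x].
Definition ext_classes : set (set M) := X `|` range realize.

Let GQ p : G p -> Q p := @generic_sub _ GG p.

Lemma generic_meet_below (D : M -> Prop) c : dfn1 X D -> G c ->
  (forall p, Q p -> le p c -> exists2 q, Q q /\ le q p & D q) ->
  exists2 p, G p & D p.
Proof.
move=> dD Gc dense.
(* Adding the conditions incompatible with [c] makes the class dense everywhere; the filter contains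
   [c] and so avoids the added part. *)
pose D' p := D p \/ ~ exists q, Q q /\ (le q p /\ le q c).
have [||p Gp [Dp|np]] := @generic_meet _ GG D'; first by rewrite /D'; dfn_tac.
- move=> p Qp; have [[q [Qq [qp qc]]]|n] := EM (exists q, Q q /\ (le q p /\ le q c)).
    have [r [Qr rq] Dr] := dense q Qq qc; exists r; last by left.
    by split=> //; apply: (forcing_trans QF) rq qp.
  by exists p; [split=> //; apply: (forcing_refl QF)|right].
- by exists p.
- have [r Gr [rp rc]] := generic_directed GG Gp Gc.
  by case: np; exists r; split=> //; apply: GQ.
Qed.

(* [Fr p v] reads: [p] forces the relation at [v]. Since no sets are added,
   set quantifiers range over [M] and no names for sets are needed. *)
Record forces (R : (nat -> M) -> Prop) (Fr : M -> (nat -> M) -> Prop) : Prop := {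
  forces_dfn : dfn X (fun v => Fr (v 0) (vtail v));
  forces_mono : forall p q v, Q p -> Q q -> le q p -> Fr p v -> Fr q v;
  forces_weak : forall p v, Q p ->
    (forall q, Q q -> le q p -> exists2 r, Q r /\ le r q & Fr r v) -> Fr p v;
  forces_truth : forall v, R v <-> exists2 p, G p & Fr p v }.

Lemma forces_ground R : dfn X R -> forces R (fun _ v => R v).
Proof.
move=> dR; split=> //.
- by apply: (@dfn_subst _ X Xp R (fun n v => v n.+1)) dR => n; apply: trm_var.
- by move=> p v Qp /(_ p Qp (forcing_refl QF Qp))[].
- move=> v; split=> [Rv|[]//]; have [p Gp] := generic_nonempty GG; by exists p.
Qed.

Lemma forces_name i j :
  forces (fun v => realize i (v j)) (fun p v => forall q, Q q -> le q p ->
    exists r, (Q r /\ le r q) /\ N i r (v j)).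
Proof.
split.
- have dNi := dN i; rewrite /vtail; dfn_tac.
- move=> p q v Qp Qq qp h r Qr rq; apply: h => //.
  exact: (forcing_trans QF) rq qp.
- move=> p v Qp h q Qq qp; have [r [Qr rq] hr] := h q Qq qp.
  have [s [[Qs sr] Ns]] := hr r Qr (forcing_refl QF Qr).
  by exists s; split=> //; split=> //; apply: (forcing_trans QF) sr rq.
- move=> v; split=> [[p Gp Np]|[p Gp h]].
    exists p => // q Qq qp; exists q; split; first by split=> //; apply: (forcing_refl QF).
    by apply: N_mono qp Np => //; apply: GQ.
  have [||q Gq Nq] := @generic_meet_below (fun q => N i q (v j)) p _ Gp.
  + by have dNi := dN i; dfn_tac.
  + by move=> q Qq qp; have [r [rq Nr]] := h q Qq qp; exists r.
  + by exists q.
Qed.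

Lemma dfn_fix (Fr : M -> (nat -> M) -> Prop) v :
  dfn X (fun v => Fr (v 0) (vtail v)) -> dfn1 X (fun p => Fr p v).
Proof.
move=> dF; apply: (@dfn_subst _ X Xp (fun v => Fr (v 0) (vtail v))
  (fun n w => if n is n'.+1 then v n' else w 0)) dF => -[|n].
  exact: trm_var.
exact: trm_cst.
Qed.

Lemma dfn_below (Fr : M -> (nat -> M) -> Prop) :
  dfn X (fun v => Fr (v 0) (vtail v)) -> dfn X (fun v => Fr (v 0) (vtail (vtail v))).
Proof.
move=> dF; apply: (@dfn_subst _ X Xp (fun v => Fr (v 0) (vtail v))
  (fun n w => if n is n'.+1 then w n.+1 else w 0)) dF => -[|n]; exact: trm_var.
Qed.

Lemma forces_not R Fr : forces R Fr ->
  forces (fun v => ~ R v) (fun p v => forall q, Q q -> le q p -> ~ Fr q v).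
Proof.
move=> [dF mF wF tF]; split.
- apply: dfn_all; apply: dfn_imp; first by dfn_tac.
  apply: dfn_imp; first by rewrite /vtail; dfn_tac.
  by apply: dfn_not; apply: dfn_below.
- move=> p q v Qp Qq qp h r Qr rq; apply: h => //.
  exact: (forcing_trans QF) rq qp.
- move=> p v Qp h q Qq qp Fq; have [r [Qr rq] hr] := h q Qq qp.
  by apply: (hr r Qr (forcing_refl QF Qr)); apply: mF rq Fq.
- move=> v; split=> [nR|[p Gp h] /tF[q Gq Fq]]; last first.
    have [r Gr [rp rq]] := generic_directed GG Gp Gq.
    by apply: (h r (GQ Gr) rp); apply: mF rq Fq; apply: GQ.
  have dF1 := @dfn_fix Fr v dF.
  pose D p := Fr p v \/ forall q, Q q -> le q p -> ~ Fr q v.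
  have dF1' : dfn1 X (fun p => Fr p v) := dF1.
  have [||p Gp [Fp|h]] := @generic_meet _ GG D; [|..|by exists p].
  + pose F1 p := Fr p v; have dF1'' : dfn1 X F1 := dF1.
    rewrite (_ : D = fun p => F1 p \/ forall q, Q q -> le q p -> ~ F1 q)//.
    dfn_tac.
  + move=> p Qp; have [[q [Qq [qp Fq]]]|n] := EM (exists q, Q q /\ (le q p /\ Fr q v)).
      by exists q => //; left.
    exists p; first by split=> //; apply: (forcing_refl QF).
    by right=> q Qq qp Fq; apply: n; exists q.
  + by case: nR; apply/tF; exists p.
Qed.

Lemma forces_and R S Fr Fs : forces R Fr -> forces S Fs ->
  forces (fun v => R v /\ S v) (fun p v => Fr p v /\ Fs p v).
Proof.
move=> [dF mF wF tF] [dH mH wH tH]; split.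
- exact: dfn_and.
- by move=> p q v Qp Qq qp [Fp Hp]; split; [apply: mF Fp|apply: mH Hp].
- by move=> p v Qp h; split; [apply: wF|apply: wH] => // q Qq /(h q Qq)[r ? []]; exists r.
- move=> v; rewrite tF tH; split=> [[[p Gp Fp] [q Gq Hq]]|[p Gp [Fp Hp]]].
    have [r Gr [rp rq]] := generic_directed GG Gp Gq; exists r => //.
    by split; [apply: mF Fp|apply: mH Hq] => //; apply: GQ.
  by split; exists p.
Qed.

Lemma forces_all R Fr : forces R Fr ->
  forces (fun v => forall x, R (scons x v)) (fun p v => forall x, Fr p (scons x v)).
Proof.
move=> [dF mF wF tF].
have dFx : dfn X (fun v => Fr (v 1) (scons (v 0) (vtail (vtail v)))).
  pose s n (w : nat -> M) := match n with 0 => w 1 | 1 => w 0 | n.+2 => w n.+2 end.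
  apply: dfn_iff (@dfn_subst _ X Xp _ s _ dF).
    move=> v; suff -> : vtail (fun n => s n v) = scons (v 0) (vtail (vtail v)) by [].
    by apply/funext => -[].
  by move=> [|[|n]]; apply: trm_var.
split.
- by apply: dfn_all.
- by move=> p q v Qp Qq qp h x; apply: mF (h x).
- by move=> p v Qp h x; apply: wF => // q Qq /(h q Qq)[r ? hr]; exists r.
- move=> v; split=> [Rv|[p Gp h] x]; last by apply/tF; exists p.
  pose Fx x p := Fr p (scons x v).
  have dFx' : dfn2 X Fx.
    apply: dfn_iff (@dfn_subst _ X Xp _ (fun n w => match n with 0 => w 0 | 1 => w 1
      | n.+2 => v n end) _ dFx); first by move=> w.
    by move=> [|[|n]]; [exact: trm_var|exact: trm_var|exact: trm_cst].
  (* Either all instances are forced or a single counterexample is. Density comes from the weak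
     clause: an instance not forced by [p] is refuted by some extension. *)
  pose D p := (forall x, Fx x p) \/ exists x, forall q, Q q -> le q p -> ~ Fx x q.
  have [||p Gp [h|[x h]]] := @generic_meet _ GG D.
  + rewrite /D; dfn_tac.
  + move=> p Qp; have [h|/existsNP[x nx]] := EM (forall x, Fx x p).
      by exists p; [split=> //; apply: (forcing_refl QF)|left].
    have [[q [Qq [qp nq]]]|n] := EM (exists q, Q q /\ (le q p /\
        forall r, Q r -> le r q -> ~ Fx x r)).
      by exists q => //; right; exists x.
    case: nx; apply: wF => // q Qq qp; apply: contrapT => nr; apply: n.
    exists q; split=> //; split=> // r Qr rq Fr'; apply: nr; by exists r.
  + by exists p.
  + have /tF[q Gq Fq] := Rv x.
    have [r Gr [rp rq]] := generic_directed GG Gp Gq.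
    by case: (h r (GQ Gr) rp); apply: mF rq Fq; apply: GQ.
Qed.

Lemma forcing_theorem R : dfn ext_classes R -> exists Fr, forces R Fr.
Proof.
elim=> {R}.
- by move=> i j; eexists; apply: forces_ground; apply: dfn_eq0.
- by move=> i j; eexists; apply: forces_ground; apply: dfn_mem0.
- move=> A j [XA|[i _ <-]]; first by eexists; apply: forces_ground; apply: dfn_class0.
  by eexists; apply: forces_name.
- by move=> R _ [Fr /forces_not]; eexists; eauto.
- by move=> R S _ [Fr hF] _ [Fs /(forces_and hF)]; eexists; eauto.
- by move=> R _ [Fr /forces_all]; eexists; eauto.
Qed.

Lemma ext_params : has_params ext_classes.
Proof. by move=> a; have [? ? ?] := Xp a; split; left. Qed.

(** For class replacement, distributivity provides one condition in the filter that decides the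
    value of [F] at every element of [a]. The image of [a] is then the image under a class of the
    ground model. *)
Lemma GB_ext : GB (gen ext_classes).
Proof.
have Sp := ext_params.
split=> //; last exact: comprehensive_gen.
move=> F SF [_ Ffun] a.
have dF : dfn ext_classes (fun v => rel_of F (v 0) (v 1)).
  apply: (dfn_gen Sp); have gp := comprehensive_params (comprehensive_gen Sp).
  by rewrite /rel_of /is_opair /is_upair; dfn_tac.
have [Fr [dFr mF wF tF]] := forcing_theorem dF.
pose P x y p := Fr p (scons x (scons y (fun=> a))).
have tP x y : rel_of F x y <-> exists2 p, G p & P x y p.
  by rewrite -tF.
have dP : dfn3 X P.
  apply: dfn_iff (@dfn_subst _ X Xp _ (fun n w => match n with 0 => w 2 | 1 => w 0
    | 2 => w 1 | _ => a end) _ dFr).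
    move=> w; rewrite /P; set u := vtail _; suff -> : u = scons (w 0) (scons (w 1) (fun=> a)) by [].
    by apply/funext => -[|[]].
  by move=> [|[|[|n]]]; [exact: trm_var|exact: trm_var|exact: trm_var|exact: trm_cst].
pose D x p := (exists y, P x y p) \/ forall q, Q q -> le q p -> forall y, ~ P x y q.
have dD : dfn2 X D by rewrite /D; dfn_tac.
have [||p Gp hp] := @generic_meet _ GG (fun p => forall x, x ∈ a -> D x p).
- by dfn_tac.
- apply: (distributive Z XG QF dD) => [x xa p Qp|x p q xa].
    have [[q [Qq [qp [y Py]]]]|n] := EM (exists q, Q q /\ (le q p /\ exists y, P x y q)).
      by exists q => //; left; exists y.
    exists p; first by split=> //; apply: (forcing_refl QF).
    by right=> q Qq qp y Py; apply: n; exists q; split=> //; split=> //; exists y.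
  move=> Qp Qq qp [[y Py]|h]; first by left; exists y; apply: mF qp Py.
  by right=> r Qr rq; apply: h => //; apply: (forcing_trans QF) rq qp.
have [||b hb] := @is_set_image _ Z X XG (fun x y => P x y p) a; first by dfn_tac.
  by move=> x y y' _ Py Py'; apply: (Ffun x); apply/tP; exists p.
exists b => y; rewrite hb; split=> -[x [xa h]]; exists x; split=> //.
  by apply/tP; exists p.
have /tP[q Gq Pq] := h; have [r Gr [rp rq]] := generic_directed GG Gp Gq.
have Pr : P x y r by apply: mF rq Pq; apply: GQ.
case: (hp x xa) => [[y' Py']|/(_ r (GQ Gr) rp y)//].
suff -> : y = y' by [].
by apply: Ffun h _; apply/tP; exists p.
Qed.

Lemma ext_forced (B : set M) : gen ext_classes B -> exists F : M -> M -> Prop,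
  [/\ dfn2 X F,
      forall p q x, Q p -> Q q -> le q p -> F p x -> F q x,
      forall p x, Q p ->
        (forall q, Q q -> le q p -> exists2 r, Q r /\ le r q & F r x) -> F p x &
      forall x, B x <-> exists2 p, G p & F p x].
Proof.
move=> /forcing_theorem[Fr [dFr mF wF tF]].
exists (fun p x => Fr p (scons x (fun=> some_set Z))); split.
- apply: dfn_iff (@dfn_subst _ X Xp _ (fun n w => match n with 0 => w 0 | 1 => w 1
    | _ => some_set Z end) _ dFr).
    move=> w; set u := vtail _; suff -> : u = scons (w 1) (fun=> some_set Z) by [].
    by apply/funext => -[].
  by move=> [|[|n]]; [exact: trm_var|exact: trm_var|exact: trm_cst].
- by move=> p q x; apply: mF.
- by move=> p x; apply: wF.
- by move=> x; rewrite -tF.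
Qed.

End Forcing.

(** * Injective sequences of ordinal length *)

Section Conditions.
Context (M : structure) (Z : ZFC M).
Implicit Types (a b p q r s t u x y z : M).

Definition has_length s a := is_ordinal a /\ forall x, x ∈ a <-> exists y, app Z s x y.

Definition injective_sequence s := (exists a, has_length s a) /\
  ((forall x y y', app Z s x y -> app Z s x y' -> y = y') /\
   (forall x x' y, app Z s x y -> app Z s x' y -> x = x')).

Definition extends s' s := forall x y, app Z s x y -> app Z s' x y.

(** The property of containing the empty set. Outside any given set there are sets with it and sets
    without it, so injectivity never prevents marking a position or leaving it unmarked. *)
Definition marker y := exists z, z ∈ y /\ forall w, ~ w ∈ z.

Lemma extends_trans s s' s'' : extends s'' s' -> extends s' s -> extends s'' s.
Proof. by move=> h h' x y /h'/h. Qed.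

Lemma length_uniq s a a' : has_length s a -> has_length s a' -> a = a'.
Proof. by move=> [_ h] [_ h']; apply: (setext Z) => x; rewrite h h'. Qed.

Lemma extends_length s s' a a' : has_length s a -> has_length s' a' ->
  extends s' s -> subset_in a a'.
Proof. by move=> [_ h] [_ h'] e x /h[y xy]; apply/h'; exists y; apply: e. Qed.

Lemma extends_restrict s s' a x y : has_length s a -> injective_sequence s' ->
  extends s' s -> x ∈ a -> app Z s' x y -> app Z s x y.
Proof.
move=> [_ h] [_ [sf _]] e /h[y' sy] sy'.
by rewrite (sf x y y')//; apply: e.
Qed.

Lemma app_range s x y : app Z s x y -> y ∈ Un Z (Un Z s).
Proof.
move=> h; apply/in_Un; exists (upair Z x y); split; last by apply/in_upair; right.
by apply/in_Un; exists (opair Z x y); split=> //; apply/in_upair; right.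
Qed.

Lemma append_sequence s a y : injective_sequence s -> has_length s a ->
  (forall x, ~ app Z s x y) -> exists s',
  [/\ injective_sequence s', has_length s' (succ Z a), extends s' s & app Z s' a y].
Proof.
move=> [_ [sf si]] [oa la] ny.
pose s' := cup Z s (sing Z (opair Z a y)).
have E x z : app Z s' x z <-> app Z s x z \/ (x = a /\ z = y).
  rewrite /app in_cup in_sing; split=> -[]; auto; first by move=> /opair_inj; right.
  by move=> [-> ->]; right.
have na z : ~ app Z s a z.
  by move=> h; apply: (@mem_irr _ Z a); apply/la; exists z.
have lS : has_length s' (succ Z a).
  split=> [|x]; first exact: ord_succ.
  rewrite in_succ la; split=> [[[z xz]|->]|[z /E[xz|[-> _]]]]; [| | |by right].
  - by exists z; apply/E; left.
  - by exists y; apply/E; right.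
  - by left; exists z.
exists s'; split=> //; last by apply/E; right.
- split; first by exists (succ Z a).
  split=> [x z z' /E[h|[-> ->]] /E[h'|[e e']]|x x' z /E[h|[-> e]] /E[h'|[e' e'']]];
    subst => //; try by [apply: sf h h'|apply: si h h'|case: (na _ h)|case: (na _ h')].
  + by case: (ny _ h).
  + by case: (ny _ h').
- by move=> x z h; apply/E; left.
Qed.

Lemma pad_sequence s a b : injective_sequence s -> has_length s a ->
  is_ordinal b -> subset_in a b -> exists s',
  [/\ injective_sequence s', has_length s' b, extends s' s &
      forall x y, app Z s' x y -> ~ x ∈ a -> ~ marker y].
Proof.
move=> [_ [sf si]] [oa la] ob ab.
(* All values of [s] are elements of [r]. Position [x] receives the pair of [x] and [r]: it is new
   by foundation, differs for different [x], and is no marker since its elements are nonempty. *)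
pose r := Un Z (Un Z s).
have GD := GB_Def Z.
have Dp := comprehensive_params (gb_comprehension GD).
have [T hT] : is_set (fun p => exists x, x ∈ b /\
    (~ x ∈ a /\ exists y, is_opair x r y /\ is_opair x y p)).
  apply: (is_set_image Z GD); first by dfn_tac.
  by move=> x p p' _ [_ [y [/(is_opairP Z)-> /(is_opairP Z)->]]]
    [_ [y' [/(is_opairP Z)-> /(is_opairP Z)->]]].
pose s' := cup Z s T.
have E x z : app Z s' x z <-> app Z s x z \/ [/\ x ∈ b, ~ x ∈ a & z = opair Z x r].
  rewrite /app in_cup hT; split=> -[]; auto.
    move=> [x' [xb [xa [y [/(is_opairP Z)-> /(is_opairP Z)]]]]].
    by move=> /opair_inj[-> ->]; right.
  move=> [xb xa ->]; right; exists x; split=> //; split=> //.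
  by exists (opair Z x r); split; apply: is_opair_opair.
have fresh x z : ~ app Z s z (opair Z x r).
  have rx : r ∈ upair Z x r by apply/in_upair; right.
  by move=> /app_range h; apply: (mem_cycle3 Z h rx); apply/in_upair; right.
have sa x z : app Z s x z -> x ∈ a by move=> h; apply/la; exists z.
exists s'; split.
- split.
    exists b; split=> // x; split=> [xb|[z /E[/sa/ab|[]]]]//.
    have [xa|xa] := EM (x ∈ a); last by exists (opair Z x r); apply/E; right.
    by have [y h] := (la x).1 xa; exists y; apply/E; left.
  split.
    move=> x z z' /E[h|[xb xa ->]] /E[h'|[xb' xa' ->]] //; first exact: sf h h'.
      by case: xa'; apply: sa h.
    by case: xa; apply: sa h'.
  move=> x x' z /E[h|[xb xa e]] /E[h'|[xb' xa' e']].
  + exact: si h h'.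
  + by rewrite e' in h; case: (fresh _ _ h).
  + by rewrite e in h'; case: (fresh _ _ h').
  + by move: e'; rewrite e => /opair_inj[].
- split=> // x; split=> [xb|[z /E[/sa/ab|[]]]]//.
  have [xa|xa] := EM (x ∈ a); last by exists (opair Z x r); apply/E; right.
  by have [y h] := (la x).1 xa; exists y; apply/E; left.
- by move=> x y h; apply/E; left.
- move=> x y /E[/sa//|[_ _ -> _ [z [/in_upair[]-> nz]]]].
    by apply: (nz x); apply/in_sing.
  by apply: (nz x); apply/in_upair; left.
Qed.

Lemma empty_exists : exists o : M, forall z, ~ z ∈ o.
Proof. by have [w [[o _ h] _]] := zfc_infinity Z; exists o. Qed.

Definition advanced s b s' :=
  [/\ injective_sequence s', has_length s' (succ Z b), extends s' s,
      exists2 y, app Z s' b y & marker y &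
      forall x y, app Z s' x y -> marker y -> (exists z, app Z s x z) \/ x = b].

Lemma advanced_exists s a b : injective_sequence s -> has_length s a ->
  is_ordinal b -> subset_in a b -> exists s', advanced s b s'.
Proof.
move=> si sa ob ab; have [s1 [s1i s1b s1s s1m]] := pad_sequence si sa ob ab.
have [o ho] := empty_exists.
(* A marker because of the empty set [o]; its other element contains all values of [s1], so [y] is
   new. *)
pose y := upair Z o (Un Z (Un Z s1)).
have [|s' [s'i s'b s's s'y]] := append_sequence s1i s1b (y := y).
  move=> x /app_range; apply: (mem_asym Z).
  by apply/in_upair; right.
exists s'; split=> //; first exact: extends_trans s's s1s.
  by exists y => //; exists o; split=> //; apply/in_upair; left.
move=> x z xz mz; have : x ∈ succ Z b by apply/(proj2 s'b); exists z.
move=> /in_succ[xb|]; last by right.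
left; apply/(proj2 sa); apply: contrapT => xa.
by apply: (s1m x z) mz => //; apply: extends_restrict s1b s'i s's xb xz.
Qed.

(** The choice is made once for each [s] and [b], so equal inputs give equal results. [S_meet]
    compares two moves through this. *)
Definition advance s b : M :=
  if pselect (exists s', advanced s b s') is left h then projT1 (cid h) else some_set Z.

Lemma advanceP s a b : injective_sequence s -> has_length s a ->
  is_ordinal b -> subset_in a b -> advanced s b (advance s b).
Proof.
move=> si sa ob ab; rewrite /advance; case: pselect => [h|[]]; first by case: cid.
exact: advanced_exists sa ob ab.
Qed.

End Conditions.

(** * Finite products of the forcing *)

Section Product.
Context (M : structure) (Z : ZFC M) (X : set (set M)) (XG : GB X) (I : finType).
Implicit Types (a b p q r s t u x y z : M) (A B : {set I}) (i : I).

Let Xp := comprehensive_params (gb_comprehension XG).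
#[local] Hint Resolve Xp : core.

Definition tag i : M := iter (enum_rank i) (succ Z) (some_set Z).

Lemma iter_succ_mem x m n : (m < n)%N -> iter m (succ Z) x ∈ iter n (succ Z) x.
Proof.
elim: n => // n IH; rewrite ltnS leq_eqVlt => /predU1P[->|/IH h] /=.
  exact: mem_succ.
by apply/in_succ; left.
Qed.

Lemma tag_inj : injective tag.
Proof.
move=> i j e; apply: enum_rank_inj; apply: val_inj => /=.
case: (ltngtP (enum_rank i) (enum_rank j)) => // /(iter_succ_mem (some_set Z));
  by rewrite -/(tag i) -/(tag j) e => /mem_irr -/(_ Z).
Qed.

(* A finite family of sets is coded by the set of its tagged elements. *)
Definition slice i p : M := collect Z (fun z => app Z p (tag i) z).

Definition tuple_code (s : I -> M) : M :=
  collect Z (fun w => exists i z, z ∈ s i /\ w = opair Z (tag i) z).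

Lemma in_slice i p z : z ∈ slice i p <-> app Z p (tag i) z.
Proof.
move: z; apply: mem_collect.
have [b hb] : is_set (fun z => exists w, w ∈ p /\ is_opair (tag i) z w).
  apply: (is_set_image Z XG); first by dfn_tac.
  by move=> w z z' _ /(is_opairP Z)-> /(is_opairP Z)/opair_inj[].
exists b => z; rewrite hb; split=> [[w [wp /(is_opairP Z) e]]|h].
  by rewrite /app -e.
by exists (opair Z (tag i) z); split=> //; apply: is_opair_opair.
Qed.

Lemma slice_tuple (s : I -> M) i : slice i (tuple_code s) = s i.
Proof.
apply: (setext Z) => z; rewrite in_slice /app mem_collect.
  split=> [[j [w [wj /opair_inj[/tag_inj-> ->]]]]//|zi]; by exists i, z.
suff [b hb] : is_set (fun w => exists j z, j \in enum I /\ (z ∈ s j /\ w = opair Z (tag j) z)).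
  exists b => w; rewrite hb; split=> -[j [y]]; first by move=> [_ h]; exists j, y.
  by move=> h; exists j, y; rewrite mem_enum.
elim: (enum I) => [|j l [b hb]].
  have [o ho] := empty_exists Z; exists o => w; split=> [/ho//|[j [y []]]//].
have [c hc] : is_set (fun w => exists y, y ∈ s j /\ is_opair (tag j) y w).
  apply: (is_set_image Z XG); first by dfn_tac.
  by move=> y w w' _ /(is_opairP Z)-> /(is_opairP Z).
exists (cup Z c b) => w; rewrite in_cup hb hc; split.
  move=> [[y [yj /(is_opairP Z) e]]|[k [y [kl h]]]].
    by exists j, y; rewrite inE eqxx.
  by exists k, y; rewrite inE kl orbT.
move=> [k [y []]]; rewrite inE => /predU1P[->|kl] h; last by right; exists k, y.
by left; exists y; case: h => ? ->; split=> //; apply: is_opair_opair.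
Qed.

Definition slice_app i p x y := app Z (slice i p) x y.

Lemma dfn_slice i : dfn3 X (slice_app i).
Proof.
apply: dfn_iff (_ : dfn X (fun v => exists z, is_opair (v 1) (v 2) z /\
  app Z (v 0) (tag i) z)); last by dfn_tac.
move=> v; rewrite /slice_app /app in_slice.
split=> [[z [/(is_opairP Z)-> h]]//|h].
by exists (opair Z (v 1) (v 2)); split=> //; apply: is_opair_opair.
Qed.
#[local] Hint Resolve dfn_slice : dfn.

(** Coordinates outside [A] are unconstrained, so one code is a condition for every [A] at once and
    the order is only a preorder. *)
Definition in_product A p := forall i, i \in A -> injective_sequence Z (slice i p).
Definition product_le A q p := forall i, i \in A -> extends Z (slice i q) (slice i p).

Lemma dfn_product A : dfn1 X (in_product A).
Proof.
apply: dfn_bigand => i; apply: dfn_imp; first exact: dfn_cst.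
apply: (@dfn_iff _ _ (fun v => (exists a, is_ordinal a /\ forall x, x ∈ a <->
    exists y, slice_app i (v 0) x y) /\
  ((forall x y y', slice_app i (v 0) x y -> slice_app i (v 0) x y' -> y = y') /\
   (forall x x' y, slice_app i (v 0) x y -> slice_app i (v 0) x' y -> x = x')))) => //.
dfn_tac.
Qed.

Lemma dfn_product_le A : dfn2 X (product_le A).
Proof.
apply: dfn_bigand => i; apply: dfn_imp; first exact: dfn_cst.
apply: (@dfn_iff _ _ (fun v => forall x y, slice_app i (v 1) x y ->
  slice_app i (v 0) x y)) => //.
dfn_tac.
Qed.

(** Slicing commutes with unions, so the union of a chain is a lower bound; its lengths are the
    unions of the lengths in the chain. *)
Lemma product_forcing A : set_closed_forcing X (in_product A) (product_le A).
Proof.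
split; [exact: dfn_product|exact: dfn_product_le| | |].
- by move=> p Qp i iA.
- by move=> p q r _ _ _ pq qr i iA; apply: extends_trans (pq i iA) (qr i iA).
move=> t tQ tc; exists (Un Z t).
  move=> i iA.
  have E x y : app Z (slice i (Un Z t)) x y <-> exists p, p ∈ t /\ app Z (slice i p) x y.
    rewrite /app in_slice /app in_Un.
    by split=> -[p [pt]] h; exists p; split=> //; move: h; rewrite in_slice.
  have cmp p q : p ∈ t -> q ∈ t -> exists r, [/\ r ∈ t, extends Z (slice i r) (slice i p) &
      extends Z (slice i r) (slice i q)].
    by move=> pt qt; case: (tc p q pt qt) => /(_ i iA) h; [exists p|exists q]; split=> // x y.
  split; last split.
  - pose len p a := is_ordinal a /\ forall x, x ∈ a <-> exists y, slice_app i p x y.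
    have dlen : dfn2 X len by rewrite /len; dfn_tac.
    have [L hL] : is_set (fun a => exists p, p ∈ t /\ len p a).
      by apply: (is_set_image Z XG) => // p a a' _; apply: length_uniq.
    exists (Un Z L); split.
      by apply: ord_Un => a /hL[p [_ []]].
    move=> x; rewrite in_Un; split=> [[a [/hL[p [pt [_ ha]]] /ha[y xy]]]|[y /E[p [pt xy]]]].
      by exists y; apply/E; exists p.
    have [[a [oa ha]] _] := tQ p pt i iA.
    by exists a; split; [apply/hL; exists p|apply/ha; exists y].
  - move=> x y y' /E[p [pt xy]] /E[q [qt xy']].
    have [r [rt /(_ _ _ xy) h /(_ _ _ xy') h']] := cmp p q pt qt.
    by have [_ [f _]] := tQ r rt i iA; apply: f h h'.
  - move=> x x' y /E[p [pt xy]] /E[q [qt xy']].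
    have [r [rt /(_ _ _ xy) h /(_ _ _ xy') h']] := cmp p q pt qt.
    by have [_ [_ f]] := tQ r rt i iA; apply: f h h'.
move=> p pt i iA x y; rewrite /app !in_slice /app => h.
by apply/in_Un; exists p.
Qed.

End Product.

(** * The construction of the generic family *)

Section Moves.
Context (M : structure) (Z : ZFC M) (X : set (set M)) (XG : GB X) (I : finType).
Context (clash : I -> I -> Prop).
Implicit Types (a b d p q s t u x y z : M) (A B : {set I}) (i j : I).
Implicit Types (st : I -> M).

Local Notation slice := (slice Z).
Local Notation tuple_code := (tuple_code Z).
Local Notation in_product := (in_product Z).
Local Notation product_le := (product_le Z).
Local Notation extends := (extends Z).
Local Notation slice_tuple := (slice_tuple Z XG).

Definition clique A := forall i j, i \in A -> j \in A -> ~ clash i j.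

Definition good st a := is_ordinal a /\
  forall i, injective_sequence Z (st i) /\ has_length Z (st i) a.

(* Only the coordinates in [A] are extended freely, to [q]; then all coordinates
   are brought to length [d], and a marker is put at position [d]. *)
Definition move A q d st i := advance Z (if i \in A then slice i q else st i) d.

Record legal A q d st : Prop := {
  legal_clique : clique A;
  legal_product : in_product A q;
  legal_le : product_le A q (tuple_code st);
  legal_ord : is_ordinal d;
  legal_length : forall i, i \in A -> forall a, has_length Z (slice i q) a -> subset_in a d;
  legal_length' : forall i a, has_length Z (st i) a -> subset_in a d }.

Lemma move_advanced A q d st a i : good st a -> legal A q d st ->
  advanced Z (if i \in A then slice i q else st i) d (move A q d st i).
Proof.
move=> [_ gs] [_ Aq _ od l l']; rewrite /move; case: ifP => iA.
  have [[b qb] ?] := Aq i iA.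
  by apply: (advanceP (a := b)) => //; [apply: Aq|apply: l qb].
have [si sa] := gs i.
by apply: (advanceP (a := a)) => //; apply: l' sa.
Qed.

Lemma move_good A q d st a : good st a -> legal A q d st ->
  good (move A q d st) (succ Z d).
Proof.
move=> ga ml; split=> [|i]; first exact/ord_succ/(legal_ord ml).
by have [] := move_advanced i ga ml.
Qed.

Lemma move_extends A q d st a i : good st a -> legal A q d st ->
  extends (move A q d st i) (st i).
Proof.
move=> ga ml; have [_ _ e _ _] := move_advanced i ga ml.
move: e; case: ifP => // iA e; apply: extends_trans e _.
by have := legal_le ml iA; rewrite slice_tuple.
Qed.

Lemma move_le A q d st a : good st a -> legal A q d st ->
  product_le A (tuple_code (move A q d st)) q.
Proof.
move=> ga ml i iA; rewrite slice_tuple.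
by have [_ _ e _ _] := move_advanced i ga ml; rewrite iA in e.
Qed.

Definition marked s x := exists2 y, app Z s x y & marker y.

Lemma move_marked A q d st a i : good st a -> legal A q d st ->
  marked (move A q d st i) d.
Proof. by move=> ga ml; have [_ _ _ [y]] := move_advanced i ga ml; exists y. Qed.

Definition common i j st : set M := [set x | marked (st i) x /\ marked (st j) x].

Lemma commonC i j st : common i j st = common j i st.
Proof. by apply/seteqP; split=> x []. Qed.

(** A clique omits one of two clashing coordinates. That one is only padded with non-markers before
    position [d], so no common marker other than [d] can arise. *)
Lemma move_common A q d st a i j : clash i j -> good st a -> legal A q d st ->
  common i j (move A q d st) `<=` common i j st `|` [set d].
Proof.
move=> cl ga ml.
have key k l : k \notin A -> common k l (move A q d st) `<=` common k l st `|` [set d].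
  move=> kA x [[y xy my] [y' xy' my']].
  have [_ _ _ _ h] := move_advanced k ga ml.
  rewrite (negbTE kA) in h; have [[z xz]|->] := h x y xy my; last by right.
  have [oa gs] := ga; have [_ sk] := gs k; have [_ sl] := gs l.
  have xa : x ∈ a by apply/(proj2 sk); exists z.
  have [_ gm] := move_good ga ml.
  left; split; [exists y => //|exists y' => //].
    exact: extends_restrict sk (proj1 (gm k)) (move_extends ga ml) xa xy.
  exact: extends_restrict sl (proj1 (gm l)) (move_extends ga ml) xa xy'.
have [iA|iA] := boolP (i \in A); last exact: key.
have [jA|jA] := boolP (j \in A); last by rewrite !(commonC i); apply: key.
by case: (legal_clique ml iA jA).
Qed.

Inductive reach : (I -> M) -> (I -> M) -> Prop :=
  | reach_refl st : reach st st
  | reach_move st A q d st' : legal A q d st -> reach (move A q d st) st' -> reach st st'.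

Lemma reach_trans st st' st'' : reach st st' -> reach st' st'' -> reach st st''.
Proof. by elim=> // {}st A q d {}st' ml _ IH /IH; apply: reach_move. Qed.

Lemma reach1 A q d st : legal A q d st -> reach st (move A q d st).
Proof. by move=> ml; apply: reach_move ml (reach_refl _). Qed.

Lemma reach_good st st' a : reach st st' -> good st a -> exists a', good st' a'.
Proof.
move=> r; elim: r a => {st st'} [st a|st A q d st' ml _ IH a ga]; first by exists a.
exact: IH (move_good ga ml).
Qed.

Lemma reach_extends st st' a i : reach st st' -> good st a -> extends (st' i) (st i).
Proof.
move=> r; elim: r a => {st st'} [st a|st A q d st' ml _ IH a ga]; first by move=> _ x y.
by apply: extends_trans (IH _ (move_good ga ml)) (move_extends ga ml).
Qed.

Lemma reach_le st st' a A : reach st st' -> good st a ->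
  product_le A (tuple_code st') (tuple_code st).
Proof. by move=> r ga i iA; rewrite !slice_tuple; apply: reach_extends r ga. Qed.

Lemma reach_common st st' a i j : clash i j -> reach st st' -> good st a ->
  finite_set (common i j st) -> finite_set (common i j st').
Proof.
move=> cl r; elim: r a => {st st'} [//|st A q d st' ml _ IH a ga f].
apply: IH (move_good ga ml) _.
apply: sub_finite_set (move_common cl ga ml) _.
by rewrite finite_setU; split=> //; apply: finite_set1.
Qed.

Lemma good_product st a A : good st a -> in_product A (tuple_code st).
Proof. by move=> [_ g] i _; rewrite slice_tuple; case: (g i). Qed.

(** All sufficiently large positions [d] are allowed, so two competing moves can be given the same
    one. *)
Lemma legal_exists A q st a : clique A -> good st a -> in_product A q ->
  product_le A q (tuple_code st) -> exists2 b, is_ordinal b &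
    forall d, is_ordinal d -> subset_in b d -> legal A q d st.
Proof.
move=> cA ga Aq le.
have [b ob hb] : exists2 b, is_ordinal b & subset_in a b /\
    forall i, i \in enum A -> forall c, has_length Z (slice i q) c -> subset_in c b.
  have : {subset enum A <= A} by move=> i; rewrite mem_enum.
  elim: (enum A) => [_|j l IH sA]; first by exists a; [case: ga|split=> [x|i]].
  have [|b ob [ab hb]] := IH; first by move=> i il; apply: sA; rewrite inE il orbT.
  have [[c lc] _] := Aq j (sA j (mem_head _ _)).
  have [oc _] := lc.
  have [bc|cb] : subset_in b c \/ subset_in c b.
    case: (ord_cmp Z ob oc) => [bc|->|cb]; [left|by left|right];
      by move=> z; apply: ord_trans.
    exists c => //; split; first by move=> z /ab/bc.
    move=> i; rewrite inE => /predU1P[->|il] e le'.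
      by move=> z; rewrite (length_uniq le' lc).
    by move=> z /(hb i il e le')/bc.
  exists b => //; split; first exact: ab.
  move=> i; rewrite inE => /predU1P[->|il] e le'; last exact: hb il e le'.
  by rewrite (length_uniq le' lc).
exists b => // d od bd; move: hb => [ab hb]; split=> //.
  by move=> i iA c lc z zc; apply/bd/(hb i _ c lc) => //; rewrite mem_enum.
move=> i c lc z zc; apply/bd/ab; have [_ /(_ i)[_ h]] := ga.
by rewrite (length_uniq h lc).
Qed.

Context (E : nat -> set M).

(* Membership of some [x] is decided in opposite ways by the two sides of [st];
   [E n] and [E m] are read as forcing relations over [A] and [B]. *)
Definition split_decision A B n m st := exists x,
  (rel_of (E n) (tuple_code st) x /\
   forall r, in_product B r -> product_le B r (tuple_code st) -> ~ rel_of (E m) r x) \/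
  ((forall r, in_product A r -> product_le A r (tuple_code st) -> ~ rel_of (E n) r x) /\
   rel_of (E m) (tuple_code st) x).

Definition two_moves A B st st2 := exists q d, legal A q d st /\
  exists q' d', legal B q' d' (move A q d st) /\ st2 = move B q' d' (move A q d st).

Definition meets A n st' := clique A ->
  (forall p, in_product A p -> exists2 q, in_product A q /\ product_le A q p & E n q) ->
  exists2 q, in_product A q /\ product_le A (tuple_code st') q & E n q.

(** If a split is within two moves of [st1], one was made. When no split occurs, this says that all
    two-move continuations of [st1] fail to split. *)
Definition separates A B n m st st' := exists st1, [/\ reach st st1, reach st1 st' &
  (exists st2, two_moves A B st1 st2 /\ split_decision A B n m st2) ->
  exists st2, [/\ reach st1 st2, reach st2 st' & split_decision A B n m st2]].

Definition marks st st' := exists d, [/\ is_ordinal d,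
  forall i a, has_length Z (st i) a -> subset_in a d & forall i, marked (st' i) d].

Definition handles (T : {set I} * {set I} * (nat * nat)) st st' :=
  let: (A, B, (n, m)) := T in
  [/\ reach st st', marks st st', meets A n st' & separates A B n m st st'].

Lemma handles_exists T st a : good st a -> exists st', handles T st st'.
Proof.
case: T => [[A B] [n m]] ga.
have [st1 r1 h1] : exists2 st1, reach st st1 & meets A n st1.
  have [[cA dense]|ns] := EM (clique A /\ forall p, in_product A p ->
      exists2 q, in_product A q /\ product_le A q p & E n q); last first.
    by exists st; [exact: reach_refl|move=> cA dense; case: ns].
  have [q [Aq le] Eq] := dense _ (good_product ga).
  have [b ob /(_ b ob (fun _ h => h)) ml] := legal_exists cA ga Aq le.
  exists (move A q b st); first exact: reach1.
  by move=> _ _; exists q => //; split=> //; apply: move_le ga ml.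
have [a1 g1] := reach_good r1 ga.
have [st2 r2 h2] : exists2 st2, reach st1 st2 &
    (exists st2, two_moves A B st1 st2 /\ split_decision A B n m st2) ->
    split_decision A B n m st2.
  have [[st2 [[q [d [l1 [q' [d' [l2 ->]]]]]] h]]|ns] :=
    EM (exists st2, two_moves A B st1 st2 /\ split_decision A B n m st2); last first.
    by exists st1; [exact: reach_refl|move=> /ns].
  exists (move B q' d' (move A q d st1)) => //.
  exact: reach_trans (reach1 l1) (reach1 l2).
have [a2 g2] := reach_good r2 g1.
(* A closing move without free coordinates: it only pads all sequences to one length and marks the
   next position in each. *)
pose A0 : {set I} := finset.set0.
have in0 i : i \in A0 -> False by rewrite finset.in_set0.
have c0 : clique A0 by move=> i j /in0.
have Q0 : in_product A0 (tuple_code st2) by move=> i /in0.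
have le0 : product_le A0 (tuple_code st2) (tuple_code st2) by move=> i /in0.
have [b ob /(_ b ob (fun _ h => h)) ml] := legal_exists c0 g2 Q0 le0.
set st3 := move A0 (tuple_code st2) b st2 in ml *.
have r3 : reach st2 st3 by apply: reach1.
exists st3; split.
- exact: reach_trans r1 (reach_trans r2 r3).
- exists b; split=> // [i c lc|i]; last exact: move_marked g2 ml.
  have [_ g2'] := g2; have [_ l2] := g2' i.
  move=> z zc; apply: (legal_length' ml l2).
  have e : extends (st2 i) (st i).
    exact: extends_trans (reach_extends r2 g1) (reach_extends r1 ga).
  exact: (extends_length lc l2 e).
- move=> cA dense; have [q [Aq le] Eq] := h1 cA dense; exists q => //; split=> //.
  move=> i iA; apply: extends_trans (le i iA).
  by apply: (reach_le (reach_trans r2 r3) g1 iA).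
- exists st1; split=> //; first exact: reach_trans r2 r3.
  by move=> /h2 h; exists st2.
Qed.

(** Each task is handled at the stage that is its code. Once suffices, since later states extend the
    one reached there. *)
Definition task k : {set I} * {set I} * (nat * nat) :=
  odflt (finset.set0, finset.set0, (0, 0)) (unpickle k).

Lemma run_exists : exists run : nat -> I -> M, [/\ exists a, good (run 0) a,
  forall i j, finite_set (common i j (run 0)) &
  forall k, handles (task k) (run k) (run k.+1)].
Proof.
have [o ho] := empty_exists Z.
pose next T st : I -> M := if pselect (exists st', handles T st st') is left h
  then projT1 (cid h) else st.
have nextP T st a : good st a -> handles T st (next T st).
  move=> /(handles_exists T) h; rewrite /next.
  by case: pselect => // h'; case: cid.
pose fix run k : I -> M := if k is k'.+1 then next (task k') (run k') else fun=> o.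
(* The empty set [o] is both the empty sequence and the ordinal zero. *)
have g0 : good (run 0) o.
  split; first by apply/(is_ordinalP Z); split=> [y /ho|y z /ho].
  have l0 : has_length Z o o.
    split; first by apply/(is_ordinalP Z); split=> [y /ho|y z /ho].
    by move=> x; split=> [/ho|[y /ho]].
  by move=> i; split=> //; split; [exists o|split=> [x y z /ho|x y z /ho]].
have gk k : exists a, good (run k) a.
  elim: k => [|k [a ga]]; first by exists o.
  have := nextP (task k) _ _ ga; rewrite -/(run k.+1).
  by case: (task k) => -[A B] [n m] [/reach_good/(_ ga)].
exists run; split; first by exists o.
  move=> i j; apply: (@sub_finite_set _ _ set0) => //.
  by move=> x [[y /ho]].
by move=> k; have [a ga] := gk k; apply: nextP ga.
Qed.

End Moves.

(** * The classes obtained from the run *)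

Section GenericFamily.
Context (M : structure) (Z : ZFC M) (X : set (set M)) (XG : GB X) (I : finType).
Context (clash : I -> I -> Prop) (clash_irr : forall i, ~ clash i i).
Context (E : nat -> set M) (E_surj : forall A, X A -> exists n, E n = A).
Context (run : nat -> I -> M).
Hypothesis run0 : exists a, good Z (run 0) a.
Hypothesis run0_common : forall i j, finite_set (common Z i j (run 0)).
Hypothesis run_step : forall k, handles Z clash E (task I k) (run k) (run k.+1).
Implicit Types (a b d p q r s t u x y z : M) (A B : {set I}) (i j : I) (k l : nat).

Let Xp := comprehensive_params (gb_comprehension XG).
#[local] Hint Resolve Xp : core.

Local Notation slice := (slice Z).
Local Notation tuple_code := (tuple_code Z).
Local Notation in_product := (in_product Z).
Local Notation product_le := (product_le Z).
Local Notation extends := (extends Z).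
Local Notation slice_tuple := (slice_tuple Z XG).
Local Notation clique := (clique clash).
Local Notation reach := (reach Z clash).

Lemma run_reach1 k : reach (run k) (run k.+1).
Proof. by have := run_step k; case: (task I k) => -[A B] [n m] []. Qed.

Lemma run_reach k l : (k <= l)%N -> reach (run k) (run l).
Proof.
elim: l => [|l IH]; first by rewrite leqn0 => /eqP->; apply: reach_refl.
rewrite leq_eqVlt => /predU1P[->|/IH h]; first exact: reach_refl.
exact: reach_trans h (run_reach1 l).
Qed.

Lemma run_good k : exists a, good Z (run k) a.
Proof. by have [a] := run0; apply: reach_good; apply: run_reach. Qed.

Lemma run_le A k l : (k <= l)%N -> product_le A (tuple_code (run l)) (tuple_code (run k)).
Proof.
move=> kl; have [a ga] := run_good k.
exact: (reach_le XG (run_reach kl) ga).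
Qed.

Lemma run_extends i k l : (k <= l)%N -> extends (run l i) (run k i).
Proof.
move=> kl; have [a ga] := run_good k.
exact: (reach_extends XG (run_reach kl) ga).
Qed.

Lemma run_product A k : in_product A (tuple_code (run k)).
Proof. by have [a ga] := run_good k; apply: (good_product XG ga). Qed.

Lemma run_injective k i : injective_sequence Z (run k i).
Proof. by have [a [_ /(_ i)[]]] := run_good k. Qed.

Definition generic_class i : set M :=
  [set z | exists k x y, z = opair Z x y /\ app Z (run k i) x y].

Lemma C_rel i x y : rel_of (generic_class i) x y <-> exists k, app Z (run k i) x y.
Proof.
rewrite (rel_ofE Z); split=> [[k [x' [y' [/opair_inj[-> ->] h]]]]|[k h]].
  by exists k.
by exists k, x, y.
Qed.

Definition run_filter A p := in_product A p /\ exists k, product_le A (tuple_code (run k)) p.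

Lemma run_filter_reach A st k : (exists a, good Z st a) ->
  reach st (run k) -> run_filter A (tuple_code st).
Proof.
move=> [a ga] r; split; first exact: (good_product XG ga).
by exists k; apply: (reach_le XG r ga).
Qed.

Lemma run_generic A : clique A ->
  generic_filter X (in_product A) (product_le A) (run_filter A).
Proof.
move=> cA; split.
- by move=> p [].
- by exists (tuple_code (run 0)); split; [exact: run_product|exists 0; apply: run_le].
- move=> p q [Qp [k kp]] [Qq [l lq]].
  exists (tuple_code (run (maxn k l))).
    by split; [exact: run_product|exists (maxn k l); apply: run_le].
  split=> i iA.
    exact: extends_trans (run_le (leq_maxl k l) iA) (kp i iA).
  exact: extends_trans (run_le (leq_maxr k l) iA) (lq i iA).
- move=> p q [Qp [k kp]] Qq pq; split=> //; exists k => i iA.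
  exact: extends_trans (kp i iA) (pq i iA).
- move=> D dD dense; have [n En] := E_surj (class_of_dfn1 Z XG dD).
  have := run_step (pickle (A, A, (n, 0))).
  rewrite /task pickleK /= => -[_ _ + _] => /(_ cA).
  by rewrite En => /(_ dense)[q [Qq le] Dq]; exists q => //; split=> //; eexists; exact: le.
Qed.

Definition name A (j : {i | i \in A}) p z :=
  exists x y, is_opair x y z /\ slice_app Z (val j) p x y.

Definition extension_by A : set (set M) :=
  [set B | X B \/ exists2 i, i \in A & B = generic_class i].

(** Brings the collection into the form required by the forcing theorem, with one name for each
    coordinate in [A]. *)
Lemma S_ext A : extension_by A = ext_classes X (run_filter A) (@name A).
Proof.
have R (j : {i | i \in A}) : realize (run_filter A) (@name A) j = generic_class (val j).
  apply/seteqP; split=> z.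
    move=> [p [_ [k kp]] [x [y [/(is_opairP Z)-> h]]]]; exists k, x, y; split=> //.
    by have := kp (val j) (valP j); rewrite slice_tuple; apply.
  move=> [k [x [y [-> h]]]]; exists (tuple_code (run k)).
    by split; [exact: run_product|exists k; apply: run_le].
  by exists x, y; split; [exact: is_opair_opair|rewrite /slice_app slice_tuple].
apply/seteqP; split=> B.
  by move=> [XB|[i iA ->]]; [left|right; exists (Sub i iA) => //; rewrite R].
by move=> [XB|[j _ <-]]; [left|right; exists (val j); [exact: valP|rewrite R]].
Qed.

Lemma dfn_name A (j : {i | i \in A}) : dfn2 X (@name A j).
Proof. by have dS := dfn_slice Z XG (val j); rewrite /name; dfn_tac. Qed.

Lemma name_mono A (j : {i | i \in A}) p q z :
  in_product A p -> in_product A q -> product_le A q p ->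
  @name A j p z -> @name A j q z.
Proof.
move=> _ _ qp [x [y [xy h]]]; exists x, y; split=> //.
exact: qp (val j) (valP j) _ _ h.
Qed.

Lemma GB_S A : clique A -> GB (gen (extension_by A)).
Proof.
move=> cA; rewrite S_ext.
exact: (GB_ext Z XG (product_forcing Z XG A) (run_generic cA) (@dfn_name A) (@name_mono A)).
Qed.

Lemma S_forced A (B : set M) : clique A -> gen (extension_by A) B -> exists F : M -> M -> Prop,
  [/\ dfn2 X F,
      forall p q x, in_product A p -> in_product A q -> product_le A q p -> F p x -> F q x,
      forall p x, in_product A p -> (forall q, in_product A q -> product_le A q p ->
        exists2 r, in_product A r /\ product_le A r q & F r x) -> F p x &
      forall x, B x <-> exists2 p, run_filter A p & F p x].
Proof.
move=> cA; rewrite S_ext.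
exact: (ext_forced Z XG (product_forcing Z XG A) (run_generic cA) (@dfn_name A) (@name_mono A)).
Qed.

Let clique1 i : clique (finset.set1 i).
Proof. by move=> j l /finset.set1P-> /finset.set1P->. Qed.

Lemma run_meet i (D : M -> Prop) : dfn1 X D ->
  (forall s, injective_sequence Z s -> exists2 s', injective_sequence Z s' /\ extends s' s &
     forall p, slice i p = s' -> D p) ->
  exists2 p, run_filter (finset.set1 i) p & D p.
Proof.
move=> dD dense; apply: (generic_meet (run_generic (@clique1 i)) dD) => p Qp.
have [s' [s'i e] h] := dense _ (Qp i (finset.set11 i)).
exists (tuple_code (fun _ : I => s')); last by apply: h; rewrite slice_tuple.
by split=> j; rewrite slice_tuple // => /finset.set1P->.
Qed.

Lemma run_filter_app i p x y : run_filter (finset.set1 i) p ->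
  app Z (slice i p) x y -> rel_of (generic_class i) x y.
Proof.
move=> [_ [k kp]] h; apply/C_rel; exists k.
by have := kp i (finset.set11 i) _ _ h; rewrite slice_tuple.
Qed.

Lemma C_total i b : is_ordinal b -> exists y, rel_of (generic_class i) b y.
Proof.
move=> ob; have dS := dfn_slice Z XG i.
have [||p pG [y h]] := @run_meet i (fun p => exists y, slice_app Z i p b y).
- by dfn_tac.
- move=> s si; have [[a sa] _] := si; have [oa _] := sa.
  have [ba|ab] : b ∈ a \/ subset_in a b.
    case: (ord_cmp Z oa ob) => [h|->|h]; [right|by right|by left].
      by move=> z; apply: ord_trans h.
    exists s; first by split.
    by move=> p ps; have [y h] := (proj2 sa b).1 ba; exists y; rewrite /slice_app ps.
  have [s' [s'i _ e [y h _] _]] := advanced_exists si sa ob ab.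
  by exists s'; [split|move=> p ps; exists y; rewrite /slice_app ps].
- by exists y; apply: run_filter_app h.
Qed.

Lemma C_surj i y : exists x, rel_of (generic_class i) x y.
Proof.
have dS := dfn_slice Z XG i.
have [||p pG [x h]] := @run_meet i (fun p => exists x, slice_app Z i p x y).
- by dfn_tac.
- move=> s si; have [[a sa] _] := si.
  have [[x h]|ny] := EM (exists x, app Z s x y).
    by exists s; [split|move=> p ps; exists x; rewrite /slice_app ps].
  have [|s' [s'i _ e h]] := append_sequence si sa (y := y).
    by move=> x h; apply: ny; exists x.
  by exists s'; [split|move=> p ps; exists a; rewrite /slice_app ps].
- by exists x; apply: run_filter_app h.
Qed.

Lemma C_fun i x y y' : rel_of (generic_class i) x y -> rel_of (generic_class i) x y' -> y = y'.
Proof.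
move=> /C_rel[k h] /C_rel[l h']; have [_ [f _]] := run_injective (maxn k l) i.
apply: (f x); first exact: run_extends (leq_maxl k l) _ _ h.
exact: run_extends (leq_maxr k l) _ _ h'.
Qed.

Lemma C_inj i x x' y : rel_of (generic_class i) x y -> rel_of (generic_class i) x' y -> x = x'.
Proof.
move=> /C_rel[k h] /C_rel[l h']; have [_ [_ f]] := run_injective (maxn k l) i.
apply: (f _ _ y); first exact: run_extends (leq_maxl k l) _ _ h.
exact: run_extends (leq_maxr k l) _ _ h'.
Qed.

Lemma C_ordinal i x y : rel_of (generic_class i) x y -> is_ordinal x.
Proof.
move=> /C_rel[k h]; have [a [oa /(_ i)[_ [_ l]]]] := run_good k.
by apply: (ord_mem Z oa); apply/l; exists y.
Qed.

(** Any one of the added classes is a bijection from the ordinals to all sets: injectivity is built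
    into the conditions, totality and surjectivity follow by density. *)
Lemma GBC_S A i : clique A -> i \in A -> GBC (gen (extension_by A)).
Proof.
move=> cA iA; apply: GB_GBC; first exact: GB_S.
exists (generic_class i); split.
- by apply: sub_gen; right; exists i.
- split=> [_ [k [x [y [-> _]]]]|x y y']; last exact: C_fun.
  by exists x, y; apply: is_opair_opair.
- by move=> x; split=> [/(C_total i)|[y /C_ordinal]].
- by move=> x x' y; apply: C_inj.
- exact: C_surj.
Qed.

Lemma C_notin i : ~ X (generic_class i).
Proof.
move=> XC; have dS := dfn_slice Z XG i.
have [||p pG [x [y [h n]]]] := @run_meet i
  (fun p => exists x y, slice_app Z i p x y /\ ~ rel_of (generic_class i) x y).
- by dfn_tac.
- (* two extensions with different values at the first free position *)
  move=> s si; have [[a sa] _] := si; have [oa _] := sa.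
  have [s1 [s1i l1 e1 [y1 h1 m1] _]] := advanced_exists si sa oa (fun _ h => h).
  have oSa := ord_succ Z oa.
  have sSa : subset_in a (succ Z a) by move=> z za; apply/in_succ; left.
  have [s2 [s2i l2 e2 _ n2]] := advanced_exists si sa oSa sSa.
  have [y2 h2] : exists y2, app Z s2 a y2.
    by apply/(proj2 l2)/in_succ; left; apply: mem_succ.
  have nm2 : ~ marker y2.
    move=> /(n2 a y2 h2)[[z /(fun h => ex_intro _ z h)]|].
      by move=> h; apply: (mem_irr Z (x := a)); apply/(proj2 sa).
    by move=> e; apply: (mem_irr Z (x := a)); rewrite {2}e; apply: mem_succ.
  have [c1|c1] := EM (rel_of (generic_class i) a y1).
    exists s2; first by split.
    move=> p ps; exists a, y2; split; first by rewrite /slice_app ps.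
    by move=> c2; apply: nm2; rewrite -(C_fun c1 c2).
  by exists s1; [split|move=> p ps; exists a, y1; rewrite /slice_app ps].
- by apply: n; apply: run_filter_app h.
Qed.

(** Coordinates of [A] may clash with coordinates of [B], so there is no product forcing for both.
    The task for the two forcing relations of [B0] replaces it. *)
Lemma S_meet A B (B0 : set M) : clique A -> clique B ->
  (forall i, i \in B -> i \notin A) ->
  gen (extension_by A) B0 -> gen (extension_by B) B0 -> X B0.
Proof.
move=> cA cB dAB gA gB.
have [F [dF mF wF tF]] := S_forced cA gA.
have [H [dH mH wH tH]] := S_forced cB gB.
have code (R : M -> M -> Prop) : dfn2 X R -> exists n, forall p x, rel_of (E n) p x <-> R p x.
  move=> dR; pose K : set M := [set z | exists p x, is_opair p x z /\ R p x].
  have XK : X K by apply: (class_of_dfn1 Z XG); rewrite /dfn1 /K /=; dfn_tac.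
  have [n En] := E_surj XK; exists n => p x; rewrite (rel_ofE Z) En; split.
    by move=> [p' [x' [/(is_opairP Z)/opair_inj[-> ->]]]].
  by move=> h; exists p, x; split=> //; apply: is_opair_opair.
have [[n En] [m Em]] := (code F dF, code H dH).
have := run_step (pickle (A, B, (n, m))).
set k := pickle _; rewrite /task pickleK /= => -[_ _ _ [st1 [r1 r1' h]]].
have [a ga] := run_good k; have [a1 g1] := reach_good r1 ga.
(* A split state on the way to the next stage of the run would put some [x] into [B0] by one
   relation and keep it out by the other. *)
have split_false st : reach st1 st -> reach st (run k.+1) ->
    ~ split_decision Z E A B n m st.
  move=> r r' [x sd]; have [a2 g2] := reach_good r g1.
  have stG D : run_filter D (tuple_code st).
    by apply: run_filter_reach r'; exists a2.
  case: sd => -[].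
    move=> /En Fx nH; have /tH[p pG Hp] : B0 x by apply/tF; exists (tuple_code st).
    have [r0 [Qr0 _] [rp rs]] := generic_directed (run_generic cB) pG (stG B).
    by apply: (nH r0) => //; apply/Em; apply: mH Hp => //; case: pG.
  move=> nF /Em Hx; have /tF[p pG Fp] : B0 x by apply/tH; exists (tuple_code st).
  have [r0 [Qr0 _] [rp rs]] := generic_directed (run_generic cA) pG (stG A).
  by apply: (nF r0) => //; apply/En; apply: mF Fp => //; case: pG.
have st1G D : run_filter D (tuple_code st1).
  by apply: run_filter_reach r1'; exists a1.
have nosplit st : ~ (two_moves Z clash A B st1 st /\ split_decision Z E A B n m st).
  by move=> hs; have [|st2 [r2 r2' /(split_false st2 r2 r2')]] := h; first by exists st.
(* No two moves from [st1] split, so membership in [B0] should already be forced at [st1], which is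
   a definition over [X]. *)
suff -> : B0 = [set x | F (tuple_code st1) x].
  by apply: (class_of_dfn1 Z XG); rewrite /dfn1 /=; dfn_tac.
apply/seteqP; split=> x; last by move=> Fx; apply/tF; exists (tuple_code st1).
move=> /tF[p0 p0G Fp0]; apply: contrapT => nFx.
(* [p] and [q] decide [x] differently, yet after padding to the same length
   they leave the same coordinates in [B] *)
have [p [Qp _] [pp0 p1]] := generic_directed (run_generic cA) p0G (st1G A).
have {p0 p0G Fp0 pp0}Fp : F p x by apply: mF pp0 Fp0 => //; case: p0G.
have [q [Qq [q1 nq]]] : exists q, in_product A q /\ (product_le A q (tuple_code st1) /\
    forall r, in_product A r -> product_le A r q -> ~ F r x).
  apply: contrapT => nq; apply: nFx; apply: wF; first by case: (st1G A).
  move=> q Qq q1; apply: contrapT => nr; apply: nq; exists q; split=> //; split=> //.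
  by move=> r Qr rq Fr; apply: nr; exists r.
have [b1 ob1 lp] := legal_exists cA g1 Qp p1.
have [b2 ob2 lq] := legal_exists cA g1 Qq q1.
have [|d od hd] := ord_bound Z (a := upair Z b1 b2).
  by move=> z /in_upair[]->.
have {}lp : legal Z clash A p d st1.
  apply: (lp d od) => z; apply: (ord_trans od); apply: hd; apply/in_upair; by left.
have {}lq : legal Z clash A q d st1.
  apply: (lq d od) => z; apply: (ord_trans od); apply: hd; apply/in_upair; by right.
have gp := move_good g1 lp; have gq := move_good g1 lq.
have same i : i \in B -> move Z A p d st1 i = move Z A q d st1 i.
  by move=> /dAB/negbTE iA; rewrite /move iA.
set stp := move Z A p d st1 in gp same *; set stq := move Z A q d st1 in gq same *.
have dn st c e D r d' : good Z st c -> legal Z clash D e d' st -> forall D' : {set I},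
    product_le D' (tuple_code st) r -> product_le D' (tuple_code (move Z D e d' st)) r.
  move=> gst lst D' le i iD'; rewrite slice_tuple.
  have := le i iD'; rewrite slice_tuple; apply: extends_trans.
  exact: (move_extends XG gst lst).
(* If some [b'] over [B] excludes [x], moving to [p] and then to [b'] splits. Otherwise [stp] forces
   [x] over [B]; [stq] agrees with it on [B], and moving to [q] splits instead. *)
have [[b' [Qb' [b'p nb']]]|nb'] := EM (exists b', in_product B b' /\
    (product_le B b' (tuple_code stp) /\
     forall r, in_product B r -> product_le B r b' -> ~ H r x)).
  have [e oe /(_ e oe (fun _ h => h)) lB] := legal_exists cB gp Qb' b'p.
  apply: (nosplit (move Z B b' e stp)); split; first by exists p, d; split=> //; exists b', e.
  have gB' := move_good gp lB.
  exists x; left; split.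
    apply/En; apply: mF Fp => //; first exact: (good_product XG gB').
    by apply: (dn _ _ _ _ _ _ gp lB); apply: (move_le XG g1 lp).
  move=> r Qr rle /Em; apply: nb' => // i iB.
  exact: extends_trans (rle i iB) (move_le XG gp lB iB).
have Hp : H (tuple_code stp) x.
  apply: wH; first exact: (good_product XG gp).
  move=> b' Qb' b'p; apply: contrapT => nr; apply: nb'; exists b'; split=> //; split=> //.
  by move=> r Qr rb Hr; apply: nr; exists r.
have lpq : product_le B (tuple_code stq) (tuple_code stp).
  by move=> i iB; rewrite !slice_tuple same.
have Hq : H (tuple_code stq) x.
  by apply: mH lpq Hp; [exact: (good_product XG gp)|exact: (good_product XG gq)].
have lr (D : {set I}) (st : I -> M) : product_le D (tuple_code st) (tuple_code st).
  by move=> i iD y z.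
(* The second move keeps [stq] as its free part; it only completes the pair of moves. *)
have [e oe /(_ e oe (fun _ h => h)) lB] :=
  legal_exists cB gq (good_product XG gq) (lr B stq).
apply: (nosplit (move Z B (tuple_code stq) e stq)).
split; first by exists q, d; split=> //; exists (tuple_code stq), e.
have gB' := move_good gq lB.
exists x; right; split; last first.
  apply/Em; apply: mH Hq; [exact: (good_product XG gq)|exact: (good_product XG gB')|].
  exact: (dn _ _ _ _ _ _ gq lB).
move=> r Qr rle /En; apply: nq => // i iA.
apply: extends_trans (rle i iA) _.
by apply: (dn _ _ _ _ _ _ gq lB); [apply: (move_le XG g1 lq)|].
Qed.

Lemma clash_common i j k : clash i j -> finite_set (common Z i j (run k)).
Proof.
move=> cl; have [a ga] := run0.
exact: (reach_common XG cl (run_reach (leq0n k)) ga (run0_common i j)).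
Qed.

(* The common markers are unbounded, but only finitely many of them lie below
   any ordinal of the model; in a model of class replacement their increasing
   enumeration would be defined at a limit ordinal. *)
Lemma clash_not_GB i j (Y : set (set M)) : clash i j -> GB Y ->
  Y (generic_class i) -> Y (generic_class j) -> False.
Proof.
move=> cl YG Yi Yj.
have Yp := comprehensive_params (gb_comprehension YG).
pose mk x := (exists y, rel_of (generic_class i) x y /\ marker y) /\
  (exists y, rel_of (generic_class j) x y /\ marker y).
have dmk : dfn1 Y mk by rewrite /mk /marker; dfn_tac.
have mk_ord x : mk x -> is_ordinal x by move=> [[y [/C_ordinal]]].
have mk_below k a x : good Z (run k) a -> x ∈ a -> mk x -> common Z i j (run k) x.
  move=> [oa ga] xa [[y [iy my]] [y' [jy my']]].
  have [_ [_ li]] := ga i; have [_ [_ lj]] := ga j.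
  have [z iz] := (li x).1 xa; have [z' jz] := (lj x).1 xa.
  split; [exists z => //|exists z' => //].
    by have <- : y = z by apply: (C_fun iy); apply/C_rel; exists k.
  by have <- : y' = z' by apply: (C_fun jy); apply/C_rel; exists k.
have len b : is_ordinal b -> exists k a, good Z (run k) a /\ b ∈ a.
  move=> /(C_total i)[y /C_rel[k h]]; have [a ga] := run_good k.
  exists k, a; split=> //; have [_ /(_ i)[_ [_ l]]] := ga; apply/l; by exists y.
have unb b : is_ordinal b -> exists2 x, mk x & b ∈ x.
  move=> /len[k [a [[oa ga] ba]]]; have := run_step k.
  case: (task I k) => -[A B] [n m] [_ [d [_ ad dm]] _ _].
  exists d; last by apply: (ad i a) => //; case: (ga i).
  have [y iy my] := dm i; have [y' jy my'] := dm j.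
  by split; [exists y|exists y']; split=> //; apply/C_rel; exists k.+1.
(* The least common marker not yet listed; [R] becomes the increasing enumeration. *)
pose Q (x s y : M) := (mk y /\ ~ y ∈ s) /\ forall z, z ∈ y -> mk z -> z ∈ s.
have [||R [dR hR]] := @recursion_rel _ Z _ YG Q.
- by rewrite /Q; dfn_tac.
- move=> x s y y' [[my ny] hy] [[my' ny'] hy'].
  case: (ord_cmp Z (mk_ord _ my) (mk_ord _ my')) => // h.
    by case: ny; apply: hy'.
  by case: ny'; apply: hy.
have {}hR x : is_ordinal x -> [/\ mk (R x), forall w, w ∈ x -> R x <> R w &
    forall z, z ∈ R x -> mk z -> exists2 w, w ∈ x & z = R w].
  move=> ox; have [s hs hQ] := hR x ox; suff : exists y, Q x s y.
    move=> /hQ[[mR nR] h]; split=> //.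
      by move=> w wx e; apply: nR; apply/hs; exists w.
    by move=> z zR mz; have /hs[w [wx e]] := h z zR mz; exists w.
  have [s' hs'] := is_set_sep Z YG s dmk.
  have [|b ob hb] := ord_bound Z (a := s'); first by move=> z /hs'[_ /mk_ord].
  have [y my by_] := unb b ob.
  have [||m [om [mm nm]] hm] := @least_ordinal _ Z Y YG (fun y => mk y /\ ~ y ∈ s).
  - by dfn_tac.
  - exists y; [exact: mk_ord|split=> // ys].
    by apply: (mem_asym Z by_); apply: hb; apply/hs'.
  - exists m; split=> // z zm mz; apply: contrapT => nz; exact: (hm z zm).
have R_incr x w : is_ordinal x -> w ∈ x -> R w ∈ R x.
  move=> ox wx; have [mx nx _] := hR x ox.
  have [mw nw hw] := hR w (ord_mem Z ox wx).
  case: (ord_cmp Z (mk_ord _ mw) (mk_ord _ mx)) => // [e|xw].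
    by case: (nx w wx).
  have [v vw e] := hw _ xw mx.
  by case: (nx v (ord_trans ox wx vw)).
have [l ol [[o [lo _]] lS]] := limit_ordinal Z XG.
(* The standard iterates of successor already give infinitely many places below [l], whether or not
   [M] has nonstandard natural numbers. *)
have nl n : iter n (succ Z) o ∈ l by elim: n => //= n; apply: lS.
have [mRl _ _] := hR l ol.
have [k [a [ga la]]] := len _ (mk_ord _ mRl).
have sub : range (fun n => R (iter n (succ Z) o)) `<=` common Z i j (run k).
  move=> _ [n _ <-]; apply: (mk_below k a) => //.
    by apply: (ord_trans (proj1 ga) la); apply: R_incr.
  by have [] := hR _ (ord_mem Z ol (nl n)).
apply: infinite_nat.
have inj : {in [set: nat] &, injective (fun n => R (iter n (succ Z) o))}.
  move=> m n _ _ /= e; case: (ltngtP m n) => // /(iter_succ_mem Z o) h.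
    have [_ /(_ _ h) ne _] := hR _ (ord_mem Z ol (nl n)); by case: ne.
  have [_ /(_ _ h) ne _] := hR _ (ord_mem Z ol (nl m)); by case: ne.
rewrite -(eq_finite_set (inj_card_eq inj)).
exact: sub_finite_set sub (clash_common k cl).
Qed.

End GenericFamily.

(** * Global choice and definable well-orders *)

Section GlobalChoice.
Context (M : structure) (Z : ZFC M) (X : set (set M)) (XG : GB X).
Implicit Types (a b r s u x y z : M).

Let Xp := comprehensive_params (gb_comprehension XG).
#[local] Hint Resolve Xp : core.

(** Initial segments of [R] may be proper classes, so listing along [R] alone might miss sets. The
    enumeration takes a new set of least rank, and among these the [R]-least. *)
Lemma global_choice_wellorder (R : set M) : X R ->
  well_orders [set: M] (rel_of R) -> global_choice X.
Proof.
move=> XR [Rirr Rtr Rtot Rmin].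
have [V [dV hV]] := cumulative_hierarchy Z XG.
have dV' : dfn2 X (has_rank V) := dV.
pose new s r := exists z, has_rank V z r /\ ~ z ∈ s.
have dnew : dfn2 X new by rewrite /new; dfn_tac.
pose Q (x s y : M) := exists r, (new s r /\ forall q, q ∈ r -> ~ new s q) /\
  ((has_rank V y r /\ ~ y ∈ s) /\
   forall z, has_rank V z r -> ~ z ∈ s -> y = z \/ rel_of R y z).
have [||F [dF hF]] := @recursion_rel _ Z _ XG Q.
- by rewrite /Q; dfn_tac.
- move=> x s y y' [r [[nr hr] [[yr ys] hy]]] [r' [[nr' hr'] [[yr' ys'] hy']]].
  have e : r = r'.
    have [_ [[or _] _]] := nr; have [_ [[or' _] _]] := nr'.
    by case: (ord_cmp Z or or') => // h; [case: (hr' _ h)|case: (hr _ h)].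
  subst r'; have [//|yy'] := hy y' yr' ys'; have [//|y'y] := hy' y yr ys.
  by case: (Rirr y I); apply: (Rtr y y' y).
have dF' : dfn2 X (fun x y => is_ordinal x /\ y = F x) := dF.
have Q_ex x s : exists y, Q x s y.
  have [z zs] : exists z, ~ z ∈ s.
    by exists s; apply: mem_irr.
  have [r0 zr0] := rank_exists Z XG dV hV z.
  have [||r [or nr] hr] := @least_ordinal _ Z X XG (new s); first by dfn_tac.
    by exists r0; [case: zr0|exists z].
  have dr : dfn1 X (fun z => ~ z ∈ s) by dfn_tac.
  have [a ha] := is_set_sep Z XG (V r) dr.
  have [//||y /ha[yr ys] hy] := Rmin a.
    by have [w [[_ wr] ws]] := nr; exists w; apply/ha.
  exists y, r; split=> //; split=> // w [_ wr] ws; apply: hy; exact/ha.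
have {}hF x : is_ordinal x -> exists2 s, forall z, z ∈ s <-> exists y, y ∈ x /\ z = F y &
    Q x s (F x) by move=> /hF[s hs /(_ (Q_ex x s))]; exists s.
have F_new x w : is_ordinal x -> w ∈ x -> F w <> F x.
  move=> /hF[s hs [r [_ [[_ ns] _]]]] wx e; apply: ns; apply/hs; by exists w.
(* If [y] were never listed, the least rank of a new set would never exceed that of [y], so [F]
   would inject the ordinals into the set [V r0]. *)
have F_surj y : exists2 x, is_ordinal x & y = F x.
  apply: contrapT => ny; have [r0 [or0 yr0]] := rank_exists Z XG dV hV y.
  apply: (no_ordinal_injection Z XG (a := V r0) dF) => // x ox.
  have [s hs [r [[[z [[or zr] _]] hr] [[[_ Fr] _] _]]]] := hF x ox.
  have ys : new s r0.
    by exists y; split=> // /hs[w [wx e]]; apply: ny; exists w => //; apply: ord_mem wx.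
  case: (ord_cmp Z or or0) => [h|e|h]; [exact: (V_mono Z hV or0 h)|by rewrite -e|].
  by case: (hr _ h).
pose G : set M := [set p | exists x y, is_opair x y p /\ (is_ordinal x /\ y = F x)].
have GE x y : rel_of G x y <-> is_ordinal x /\ y = F x.
  rewrite (rel_ofE Z); split=> [[x' [y' [/(is_opairP Z)/opair_inj[-> ->]]]]//|h].
  by exists x, y; split=> //; apply: is_opair_opair.
exists G; split.
- pose Fr x y := is_ordinal x /\ y = F x; have dFr : dfn2 X Fr := dF.
  apply: (class_of_dfn1 Z XG).
  rewrite (_ : G = [set p | exists x y, is_opair x y p /\ Fr x y])//.
  by rewrite /dfn1 /=; dfn_tac.
- split=> [p [x [y [h _]]]|x y y' /GE[_ ->] /GE[_ ->]//]; by exists x, y.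
- by move=> x; split=> [ox|[y /GE[]]//]; exists (F x); apply/GE.
- move=> x x' y /GE[ox ->] /GE[ox' e].
  by case: (ord_cmp Z ox ox') => // h; [case: (F_new x' x)|case: (F_new x x')].
- by move=> y; have [x ox e] := F_surj y; exists x; apply/GE.
Qed.

Lemma wellorder_of_global_choice : global_choice X -> exists R : set M,
  [/\ X R, class_relation R & well_orders [set: M] (rel_of R)].
Proof.
move=> [F [XF [_ Ffun] Fdom Finj Fsurj]].
have F_ord x y : rel_of F x y -> is_ordinal x by move=> h; apply/Fdom; exists y.
pose R : set M := [set p | exists y y', is_opair y y' p /\
  exists x x', (rel_of F x y /\ rel_of F x' y') /\ x ∈ x'].
have RE y y' : rel_of R y y' <-> exists x x', (rel_of F x y /\ rel_of F x' y') /\ x ∈ x'.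
  rewrite (rel_ofE Z); split=> [[z [z' [/(is_opairP Z)/opair_inj[-> ->]]]]//|h].
  by exists y, y'; split=> //; apply: is_opair_opair.
exists R; split.
- by apply: (class_of_dfn1 Z XG); rewrite /dfn1 /R /=; dfn_tac.
- by move=> p [y [y' [h _]]]; exists y, y'.
split.
- move=> y _ /RE[x [x' [[xy x'y] xx']]].
  by move: xx'; rewrite (Finj _ _ _ xy x'y) => /mem_irr; apply.
- move=> y y' y'' _ _ _ /RE[x [x' [[xy xy'] h]]] /RE[z [z' [[zy' zy''] h']]].
  apply/RE; exists x, z'; split=> //; apply: (ord_trans (F_ord _ _ zy'') h').
  by rewrite -(Finj _ _ _ xy' zy').
- move=> y y' _ _; have [x xy] := Fsurj y; have [x' xy'] := Fsurj y'.
  case: (ord_cmp Z (F_ord _ _ xy) (F_ord _ _ xy')) => h.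
  + by apply: Or31; apply/RE; exists x, x'.
  + by apply: Or32; apply: (Ffun x) => //; rewrite h.
  + by apply: Or33; apply/RE; exists x', x.
- move=> a _ [y ya]; have [x xy] := Fsurj y.
  have [||m [om [z [za mz]]] hm] := @least_ordinal _ Z X XG
      (fun x => exists y, y ∈ a /\ rel_of F x y).
  + by dfn_tac.
  + by exists x; [exact: F_ord xy|exists y].
  exists z => // w wa; have [v vw] := Fsurj w.
  case: (ord_cmp Z om (F_ord _ _ vw)) => h.
  + by right; apply/RE; exists m, v.
  + by left; apply: (Ffun m) => //; rewrite h.
  + by case: (hm v h); exists w.
Qed.

End GlobalChoice.

Lemma GBC_Def (M : structure) : ZFC M -> has_definable_global_wellorder M ->
  GBC (@Def M).
Proof.
move=> Z [R [DR _ wR]]; have DG := GB_Def Z; apply: GB_GBC => //.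
exact: (global_choice_wellorder Z DG DR wR).
Qed.

(** Countability of [X] enters here: an enumeration of its classes lets the run handle every dense
    class and every pair of forcing relations. *)
Lemma generic_family (M : structure) (X : set (set M)) (I : finType)
    (clash : I -> I -> Prop) :
  GB X -> countable X -> (forall i, ~ clash i i) ->
  exists C : I -> set M,
  let S (A : {set I}) := [set B | X B \/ exists2 i, i \in A & B = C i] in
  [/\ forall A i, clique clash A -> i \in A -> GBC (gen (S A)),
      forall (A B : {set I}) B0, clique clash A -> clique clash B ->
        (forall i, i \in B -> i \notin A) -> gen (S A) B0 -> gen (S B) B0 -> X B0,
      forall i, ~ X (C i) &
      forall i j Y, clash i j -> GB Y -> Y (C i) -> Y (C j) -> False].
Proof.
move=> XG /countable_injP[f finj] irr; have Z := gb_zfc XG.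
have [E hE] : exists E : nat -> set M, forall A, X A -> exists n, E n = A.
  exists (fun n => if pselect (exists A, X A /\ f A = n) is left h
    then projT1 (cid h) else classical_sets.set0) => A XA.
  exists (f A); case: pselect => [h|[]]; last by exists A.
  by case: cid => B /= [XB fB]; apply: finj => //; rewrite inE.
have [run [g0 f0 hrun]] := run_exists Z XG clash E.
exists (generic_class Z run); split.
- by move=> A i cA iA; apply: (GBC_S XG irr hE g0 hrun cA iA).
- by move=> A B B0; apply: (S_meet XG hE g0 hrun).
- exact: (C_notin XG irr hE g0 hrun).
- by move=> i j Y; apply: (clash_not_GB XG irr hE g0 f0 hrun).
Qed.

(** * Embedding a finite partial order *)

Import Order.LTheory.

Definition unbounded (d : Order.disp_t) (P : finPOrderType d) (p q : P) : Prop :=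
  ~ exists r : P, (p <= r)%O /\ (q <= r)%O.

Lemma unbounded_irr (d : Order.disp_t) (P : finPOrderType d) (p : P) : ~ unbounded p p.
Proof. by apply; exists p. Qed.

Section Embedding.
Context (M : structure) (X : set (set M)) (XG : GB X).
Context (disp : Order.disp_t) (P : finPOrderType disp).
Context (live : pred P) (dead_least : forall p q : P, ~~ live p -> (p <= q)%O).
Context (C : P -> set M).
Implicit Types (p q r : P).

Local Notation clash := (@unbounded disp P).
Let S (A : {set P}) := [set B | X B \/ exists2 i, i \in A & B = C i].

Hypothesis S_GBC : forall A p, clique clash A -> p \in A -> GBC (gen (S A)).
Hypothesis S_meet : forall (A B : {set P}) B0, clique clash A -> clique clash B ->
  (forall i, i \in B -> i \notin A) -> gen (S A) B0 -> gen (S B) B0 -> X B0.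
Hypothesis C_notin : forall p, ~ X (C p).
Hypothesis C_clash : forall p q Y, clash p q -> GB Y -> Y (C p) -> Y (C q) -> False.

(** Live elements carry a generic class. For (1) and (3) the least element is not live, so that it
    is sent to [X]. For (2) all are live, since without a generic class global choice would fail. *)
Definition below p : {set P} := finset.finset (fun r => (r <= p)%O && live r).
Definition embed p : set (set M) := gen (S (below p)).

Lemma in_below p r : (r \in below p) = (r <= p)%O && live r.
Proof. by rewrite finset.in_set. Qed.

Lemma clique_below p : clique clash (below p).
Proof.
by move=> i j; rewrite !in_below => /andP[ip _] /andP[jp _]; apply; exists p.
Qed.

Lemma clique_single p : clique clash (finset.set1 p).
Proof. by move=> i j /finset.set1P-> /finset.set1P->; apply; exists p. Qed.

Lemma sub_embed p : X `<=` embed p.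
Proof. by move=> A XA; apply: sub_gen; left. Qed.

Lemma C_embed p r : (r <= p)%O -> live r -> embed p (C r).
Proof. by move=> rp lr; apply: sub_gen; right; exists r; rewrite ?in_below ?rp. Qed.

Lemma embed_live p : live p -> GBC (embed p).
Proof.
by move=> lp; apply: (S_GBC (p := p)); [exact: clique_below|rewrite in_below lexx lp].
Qed.

Lemma embed_dead p : ~~ live p -> embed p = X.
Proof.
move=> np; have x0 := some_set (gb_zfc XG).
rewrite /embed (_ : S (below p) = X).
  exact: (gen_comprehensive x0 (gb_comprehension XG)).
apply/seteqP; split=> A; last by left.
move=> [//|[r]]; rewrite in_below => /andP[rp lr] _.
suff e : r = p by rewrite e (negbTE np) in lr.
by apply/eqP; rewrite eq_le rp dead_least.
Qed.

Lemma embed_mono p q : (p <= q)%O -> embed p `<=` embed q.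
Proof.
move=> pq; apply: gen_sub => A [XA|[r]]; first by left.
rewrite in_below => /andP[rp lr] ->; right; exists r => //.
by rewrite in_below lr (le_trans rp pq).
Qed.

Lemma embed_meet p q : (forall r, (r <= p)%O -> (r <= q)%O -> ~~ live r) ->
  embed p `&` embed q `<=` X.
Proof.
move=> dpq A [Ap Aq]; apply: (S_meet (A := below p) (B := below q) (B0 := A)) => //.
- exact: clique_below.
- exact: clique_below.
- move=> i; rewrite !in_below => /andP[iq li]; rewrite li andbT.
  by apply/negP => ip; have := dpq i ip iq; rewrite li.
Qed.

(** If [p] is not below [q], the index sets [{p}] and [below q] are disjoint, so [C p] in both
    extensions would lie in [X]. *)
Lemma embed_reflects p q : embed p `<=` embed q -> (p <= q)%O.
Proof.
move=> epq; apply/idP; apply: contrapT => /negP npq.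
have lp : live p by apply: contrapT => /negP /dead_least h; rewrite h in npq.
apply: (C_notin (p := p)).
apply: (S_meet (A := finset.set1 p) (B := below q)).
- exact: clique_single.
- exact: clique_below.
- move=> i; rewrite in_below finset.in_set1 => /andP[iq _].
  by apply: contra npq => /eqP <-.
- by apply: sub_gen; right; exists p => //; apply: finset.set11.
- by apply: epq; apply: C_embed.
Qed.

Lemma embed_not_sub p r : (r <= p)%O -> live r -> ~ embed p `<=` X.
Proof. by move=> rp lr /(_ _ (C_embed rp lr)); apply: C_notin. Qed.

Hypothesis embed_GBC : forall p, GBC (embed p).

Lemma embed_embedding : embedding_in_Re embed.
Proof.
split; first exact: embed_GBC.
by move=> p q; split; [exact: embed_mono|exact: embed_reflects].
Qed.

Lemma embed_upper : preserves_upper_bounds embed.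
Proof.
move=> p q; split=> [[r [pr qr]]|[Y [YG pY qY]]].
  by exists (embed r); split; [exact: embed_GBC|exact: embed_mono|exact: embed_mono].
apply: contrapT => cl.
(* An element that is not live lies below all others, so [q] itself would bound the pair. *)
have lp : live p.
  apply: contrapT => /negP /dead_least h; apply: cl; exists q; by split.
have lq : live q.
  apply: contrapT => /negP /dead_least h; apply: cl; exists p; by split.
apply: (C_clash cl (GBC_GB YG)); [apply: pY|apply: qY]; exact: C_embed.
Qed.

End Embedding.

Unset Implicit Arguments.

Theorem corollary1p78 (M : structure) (M_ZFC : ZFC M)
    (M_countable : countable [set: M]) :
  [/\ (* (1) *)
      has_definable_global_wellorder M ->
      forall (d : Order.disp_t) (P : finPOrderType d) (zero : P),
        (forall p : P, (zero <= p)%O) ->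
        exists e : P -> set (set M),
          [/\ embedding_in_Re e, e zero = @Def M, preserves_upper_bounds e &
              preserves_nonzero_lower_bounds zero e],
      (* (2) *)
      ~ has_definable_global_wellorder M ->
      forall (d : Order.disp_t) (P : finPOrderType d),
        ~ (exists zero : P, forall p : P, (zero <= p)%O) ->
        exists e : P -> set (set M),
          [/\ embedding_in_Re e, preserves_upper_bounds e &
              preserves_lower_bounds e] &
      (* (3) *)
      forall X : set (set M), Re_GBC X -> countable X ->
      forall (d : Order.disp_t) (P : finPOrderType d) (zero : P),
        (forall p : P, (zero <= p)%O) ->
        exists e : P -> set (set M),
          [/\ embedding_in_Re e, (forall p : P, X `<=` e p), e zero = X,
              preserves_upper_bounds e &
              preserves_nonzero_lower_bounds_over zero X e] ].
Proof.
have x0 := some_set M_ZFC.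
have DefG := GB_Def M_ZFC.
have Defc := countable_Def x0 M_countable.
(* The common part of (1) and (3); (1) takes [Def M] for [X]. Nonexistence and existence of nonzero
   lower bounds are reduced to its last two clauses. *)
have over (X : set (set M)) (d : Order.disp_t) (P : finPOrderType d) (zero : P) :
    GBC X -> countable X -> (forall p : P, (zero <= p)%O) ->
    exists e : P -> set (set M), [/\ embedding_in_Re e,
      (forall p : P, X `<=` e p) /\ e zero = X, preserves_upper_bounds e,
      forall p q, ~ has_nonzero_lower_bound zero p q -> e p `&` e q `<=` X &
      forall p, p <> zero -> ~ e p `<=` X].
  move=> XG Xc zP.
  have [C [h1 h2 h3 h4]] := generic_family (GBC_GB XG) Xc (@unbounded_irr d P).
  pose live (p : P) := p != zero.
  have dead p q : ~~ live p -> (p <= q)%O by rewrite negbK => /eqP->.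
  have nz : ~~ live zero by rewrite negbK.
  have eG p : GBC (embed X live C p).
    have [lp|np] := boolP (live p); first exact: (embed_live h1).
    by rewrite (embed_dead (GBC_GB XG) dead).
  exists (embed X live C); split.
  - exact: (embed_embedding dead h2 h3 eG).
  - by split=> [p|]; [exact: sub_embed|exact: (embed_dead (GBC_GB XG) dead)].
  - exact: (embed_upper dead h4 eG).
  - move=> p q nb; apply: (embed_meet h2) => r rp rq.
    by apply/negP => /eqP rz; apply: nb; exists r.
  - by move=> p /eqP pz; apply: (embed_not_sub h3 (lexx p)).
split.
- move=> wo d P zero zP; have DG := GBC_Def M_ZFC wo.
  have [e [emb [De ez] ub meet nsub]] := over _ d P zero DG Defc zP.
  exists e; split=> // p q; split.
    move=> [r [rp rq rz]]; exists (e r); have [eG le] := emb; split=> //.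
    + exact/le.
    + exact/le.
    + by move=> er; apply: (nsub r rz); rewrite er.
  (* Every realization includes [Def M], so one contained in it is equal to it. *)
  move=> [Y [YG Yp Yq YD]]; apply: contrapT => /meet h; apply: YD.
  apply/seteqP; split=> [A YA|]; first by apply: h; split; [exact: Yp|exact: Yq].
  exact: (Def_sub x0 (gb_comprehension (GBC_GB YG))).
- move=> nwo d P _.
  have [C [h1 h2 h3 h4]] := generic_family DefG Defc (@unbounded_irr d P).
  pose live (p : P) := true.
  have dead p q : ~~ live p -> (p <= q)%O by [].
  have eG p : GBC (embed (@Def M) live C p) by apply: (embed_live h1).
  exists (embed (@Def M) live C); split.
  + exact: (embed_embedding dead h2 h3 eG).
  + exact: (embed_upper dead h4 eG).
  move=> p q; split=> [[r [rp rq]]|[Y [YG Yp Yq]]].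
    by exists (embed (@Def M) live C r); split; [|exact: embed_mono|exact: embed_mono].
  apply: contrapT => nb; apply: nwo.
  (* Without a common lower bound in [P] the index sets are disjoint, so [Y] is contained in
     [Def M], and the well-order from global choice in [Y] would be definable. *)
  have YD : Y `<=` @Def M.
    move=> A YA; apply: (embed_meet h2 (p := p) (q := q)); last first.
      by split; [exact: Yp|exact: Yq].
    by move=> r rp rq; exfalso; apply: nb; exists r.
  have [R [YR cR wR]] := wellorder_of_global_choice M_ZFC (GBC_GB YG) (gbc_global_choice YG).
  by exists R; split=> //; apply: YD.
- move=> X XG Xc d P zero zP.
  have [e [emb [Xe ez] ub meet nsub]] := over X d P zero XG Xc zP.
  exists e; split=> // p q; split.
    move=> /meet h; split=> // Y _ Yp Yq A YA.
    by apply: h; split; [exact: Yp|exact: Yq].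
  (* For a nonzero lower bound [r] the realization [e r] would be contained in [X], although it
     contains a class outside [X]. *)
  move=> [_ _ _ glb] [r [rp rq rz]]; have [eG le] := emb.
  by apply: (nsub r rz); apply: (glb (e r)) => //; exact/le.
Qed.
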